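(* Let $f:\mathbb{R}^n\times\mathbb{R}^m\to\mathbb{R}^n$ and $h:\mathbb{R}^n\to\mathbb{R}^p$ be locally Lipschitz with $f(0,0)=0$, $h(0)=0$, and consider the system $\dot x=f(x,u)$, $y=h(x)$. The following are equivalent: (1) The system is IOS. (2) The system is OLIOS under output redefinition, i.e. there exist a locally Lipschitz map $h_0:\mathbb{R}^n\to\mathbb{R}_{\ge 0}$ with $h_0(0)=0$ and a function $\chi\in\mathcal{K}_\infty$ such that $h_0(\xi)\ge \chi(|h(\xi)|)$ for all $\xi\in\mathbb{R}^n$ and the system $\dot x=f(x,u)$, $y=h_0(x)$ is OLIOS.
   Context: Inputs are measurable, locally essentially bounded functions $u:[0,\infty)\to\mathbb{R}^m$; $\|u\|$ denotes the (possibly infinite) essential supremum of $|u(t)|$, with $|\cdot|$ the Euclidean norm. For an initial state $\xi$ and input $u$, $x(\cdot,\xi,u)$ is the unique maximal solution of $\dot x=f(x,u)$, $x(0)=\xi$, and $y(t,\xi,u)=h(x(t,\xi,u))$ (for a redefined output map, $y$ is computed with that map). The system is forward complete if every such solution is defined for all $t\ge 0$. A function $\gamma:[0,\infty)\to[0,\infty)$ is of class $\mathcal{K}$ if it is continuous, strictly increasing and $\gamma(0)=0$; of class $\mathcal{K}_\infty$ if moreover unbounded; $\beta:[0,\infty)^2\to[0,\infty)$ is of class $\mathcal{KL}$ if $\beta(\cdot,t)\in\mathcal{K}$ for each $t$ and $\beta(s,\cdot)$ decreases to $0$ for each $s$. A forward complete system is IOS (input to output stable) if there exist $\beta\in\mathcal{KL}$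 and $\gamma\in\mathcal{K}$ such that $|y(t,\xi,u)|\le \beta(|\xi|,t)+\gamma(\|u\|)$ for all $t\ge0$, all inputs $u$ and all $\xi\in\mathbb{R}^n$. It is OLIOS (output-Lagrange input to output stable) if it is IOS and there exist $\sigma_1,\sigma_2\in\mathcal{K}$ such that $|y(t,\xi,u)|\le\max\{\sigma_1(|h(\xi)|),\sigma_2(\|u\|)\}$ for all $t\ge0$, all $u$ and all $\xi$ (with $h$ the output map of that system). *)

(* Defs.v *)
From HB Require Import structures.
From mathcomp Require Import all_boot all_order all_algebra.
From mathcomp Require Import all_classical all_reals all_analysis.
Set Implicit Arguments. Unset Strict Implicit. Unset Printing Implicit Defensive.
Import Order.TTheory GRing.Theory Num.Theory.
Import numFieldNormedType.Exports.
Local Open Scope classical_set_scope.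
Local Open Scope ring_scope.

Section Defs.
Variable R : realType.

Definition eucl (k : nat) (v : 'rV[R]_k) : R :=
  Num.sqrt (\sum_(i < k) v ord0 i ^+ 2).

Definition classK (g : R -> R) : Prop :=
  g 0 = 0 /\ {within `[0, +oo[, continuous g} /\
  (forall a b : R, 0 <= a -> a < b -> g a < g b).

Definition classKinf (g : R -> R) : Prop :=
  classK g /\ (forall M : R, exists s : R, 0 <= s /\ M <= g s).

Definition classKL (b : R -> R -> R) : Prop :=
  (forall t : R, 0 <= t -> classK (fun s => b s t)) /\
  (forall s : R, 0 <= s ->
     (forall t1 t2 : R, 0 <= t1 -> t1 <= t2 -> b s t2 <= b s t1) /\
     (b s t @[t --> +oo] --> (0 : R))).

Definition loclip (k l : nat) (g : 'rV[R]_k -> 'rV[R]_l) : Prop :=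
  forall r : R, exists L : R, forall a b : 'rV[R]_k,
    eucl a <= r -> eucl b <= r -> eucl (g a - g b) <= L * eucl (a - b).

Definition loclip2 (k m l : nat) (g : 'rV[R]_k -> 'rV[R]_m -> 'rV[R]_l) : Prop :=
  forall r : R, exists L : R, forall (a b : 'rV[R]_k) (c d : 'rV[R]_m),
    eucl a <= r -> eucl b <= r -> eucl c <= r -> eucl d <= r ->
    eucl (g a c - g b d) <= L * (eucl (a - b) + eucl (c - d)).

Definition input (m : nat) (u : R -> 'rV[R]_m) : Prop :=
  (forall j : 'I_m, measurable_fun (`[0, +oo[ : set R) (fun t => u t ord0 j)) /\
  (forall T : R, exists M : R,
     {ae (@lebesgue_measure R), forall t, 0 <= t <= T -> eucl (u t) <= M}).

Definition ess_bounded (m : nat) (u : R -> 'rV[R]_m) (M : R) : Prop :=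
  {ae (@lebesgue_measure R), forall t, 0 <= t -> eucl (u t) <= M}.

Definition itv0 (t : R) : set R := `[0, t].

(* (Caratheodory) solution of x' = f(x,u), x(0) = xi, defined on [0,+oo):
   for every t >= 0, s |-> f(x s, u s) is integrable on [0,t] and
   x(t) = xi + int_0^t f(x s, u s) ds (componentwise). *)
Definition solution (n m : nat) (f : 'rV[R]_n -> 'rV[R]_m -> 'rV[R]_n)
  (xi : 'rV[R]_n) (u : R -> 'rV[R]_m) (x : R -> 'rV[R]_n) : Prop :=
  forall t : R, 0 <= t -> forall i : 'I_n,
    (@lebesgue_measure R).-integrable (itv0 t)
       (fun s => (f (x s) (u s) ord0 i)%:E) /\
    ((x t ord0 i)%:E = (xi ord0 i)%:E +
       \int[@lebesgue_measure R]_(s in itv0 t) (f (x s) (u s) ord0 i)%:E)%E.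

(* forward completeness: the (unique) maximal solution exists on [0,+oo) *)
Definition forward_complete (n m : nat) (f : 'rV[R]_n -> 'rV[R]_m -> 'rV[R]_n)
  : Prop :=
  forall (xi : 'rV[R]_n) (u : R -> 'rV[R]_m), input u ->
    exists x : R -> 'rV[R]_n, solution f xi u x.

Definition IOS (n m p : nat) (f : 'rV[R]_n -> 'rV[R]_m -> 'rV[R]_n)
  (h : 'rV[R]_n -> 'rV[R]_p) : Prop :=
  forward_complete f /\
  exists (beta : R -> R -> R) (gamma : R -> R), classKL beta /\ classK gamma /\
    forall (xi : 'rV[R]_n) (u : R -> 'rV[R]_m) (x : R -> 'rV[R]_n) (M : R),
      input u -> solution f xi u x -> ess_bounded u M ->
      forall t : R, 0 <= t -> eucl (h (x t)) <= beta (eucl xi) t + gamma M.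

Definition OLIOS (n m p : nat) (f : 'rV[R]_n -> 'rV[R]_m -> 'rV[R]_n)
  (h : 'rV[R]_n -> 'rV[R]_p) : Prop :=
  IOS f h /\
  exists sigma1 sigma2 : R -> R, classK sigma1 /\ classK sigma2 /\
    forall (xi : 'rV[R]_n) (u : R -> 'rV[R]_m) (x : R -> 'rV[R]_n) (M : R),
      input u -> solution f xi u x -> ess_bounded u M ->
      forall t : R, 0 <= t ->
        eucl (h (x t)) <= Num.max (sigma1 (eucl (h xi))) (sigma2 M).

Definition scal1 (n : nat) (g : 'rV[R]_n -> R) : 'rV[R]_n -> 'rV[R]_1 :=
  fun xi => \row_(j < 1) g xi.

End Defs.

(* Main.v *)
(** Write [|y|] for the output along a trajectory and [gam s = gamma s + s].
  The new output is built from the envelope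
    [V xi = sup { |y(t, xi, u)| - 2 gam(M) : t >= 0, |u| <= M }],
  which dominates [|h|] (take [t = 0], [u = 0]) and vanishes at [0].  Concatenating
  inputs gives [V(x(t)) <= V(xi) + 2 gam(M)] and [V(x(t)) <= beta(|xi|, t) + gam(M)].
  Where [V > eps], only bounded times and inputs contribute to the supremum, so
  [V] is Lipschitz there on bounded sets provided that reachable sets are bounded;
  since the constant may blow up as [eps -> 0], one takes [h_0 = rho(V)] with
  [rho] of class K_infinity flat enough at [0].

  Boundedness of reachable sets follows from forward completeness alone: if
  trajectories from near [p] escape to infinity within a bounded time, short steps
  lead to further such points; the short-time flow is locally onto, so the initial
  state can be adjusted at every step to hit them exactly, and the adjusted initial
  states converge to one from which a single input produces a blow-up. *)

Require Import Defs.
From HB Require Import structures.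
From mathcomp Require Import all_boot all_order all_algebra.
From mathcomp Require Import all_classical all_reals all_analysis.
From mathcomp Require Import measurable_realfun.
From mathcomp Require Import ring lra.
Set Implicit Arguments. Unset Strict Implicit. Unset Printing Implicit Defensive.
Import Order.TTheory GRing.Theory Num.Theory.
Import numFieldNormedType.Exports.
Local Open Scope classical_set_scope.
Local Open Scope ring_scope.

(** * Indefinite integrals *)

Lemma integrable_union d (T : measurableType d) (R : realType)
    (mu : {measure set T -> \bar R}) (A B : set T) (k : T -> \bar R) :
  measurable A -> measurable B -> [disjoint A & B] ->
  mu.-integrable A k -> mu.-integrable B k -> mu.-integrable (A `|` B) k.
Proof.
move=> mA mB AB /integrableP[mkA iA] /integrableP[mkB iB].
have mk : measurable_fun (A `|` B) k by apply/measurable_funU.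
apply/integrableP; split => //.
rewrite ge0_integral_setU//; first exact: lte_add_pinfty.
exact: measurableT_comp.
Qed.

Section Primitive.
Context {R : realType}.
Notation leb := (@lebesgue_measure R).
Implicit Types (g k X Y : R -> R) (r s t T : R).

Definition translation (s : R) : measurableTypeR R -> measurableTypeR R :=
  fun r => r + s.

Lemma measurable_translation (s : R) : measurable_fun setT (translation s).
Proof. by apply: measurable_funD. Qed.

HB.instance Definition _ (s : R) :=
  isMeasurableFun.Build _ _ _ _ (translation s) (measurable_translation s).

(** Both measures give a half-open interval its length, and this determines Lebesgue measure. *)
Lemma lebesgue_measure_translation (s : R) (A : set (measurableTypeR R)) :
  measurable A -> pushforward leb (translation s) A = leb A.
Proof.
move=> mA; apply/esym.
apply: (@lebesgue_measure_unique _ (pushforward leb (translation s))) => //= _ [[a b]] _ <-.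
rewrite /pushforward/=.
have -> : translation s @^-1` `]a, b] = `]a - s, b - s]%classic.
  by apply/seteqP; split=> r /=; rewrite /translation !in_itv/= ltrBlDr lerBrDr.
rewrite !lebesgue_measure_itv/= !lte_fin ltrD2r.
by case: ifP => // _; rewrite -!EFinD; congr (_%:E); ring.
Qed.

Lemma integral_translation (s : R) (D : set (measurableTypeR R)) g :
  measurable D -> leb.-integrable D (EFin \o g) ->
  leb.-integrable (translation s @^-1` D) (EFin \o (g \o translation s)) /\
  \int[leb]_(r in translation s @^-1` D) g (translation s r) = \int[leb]_(r in D) g r.
Proof.
move=> mD intg.
have mpD : measurable (translation s @^-1` D).
  by rewrite -[X in measurable X]setTI; exact: measurable_translation.
have mG : measurable_fun setT ((EFin \o g) \_ D).
  by apply/(measurable_restrictT _ mD); exact: (measurable_int leb).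
have intG : leb.-integrable setT ((EFin \o g) \_ D) by rewrite -integrable_mkcond.
have e1 : ((EFin \o g) \_ D) \o translation s =
    (EFin \o (g \o translation s)) \_ (translation s @^-1` D).
  by apply/funext => r; rewrite /patch/=; congr (if _ then _ else _).
have intGs : leb.-integrable setT (((EFin \o g) \_ D) \o translation s).
  apply/integrableP; split.
    by apply: measurableT_comp => //; exact: measurable_translation.
  have /integrableP[_] := intG.
  congr (_ < _)%E.
  transitivity (\int[pushforward leb (translation s)]_x `|((EFin \o g) \_ D) x|)%E.
    by apply: eq_measure_integral => A mA _; exact/esym/lebesgue_measure_translation.
  rewrite (ge0_integral_pushforward (measurable_translation s))//.
  exact: measurableT_comp.
split.
  by rewrite integrable_mkcond// -e1.
rewrite /Rintegral; congr fine.
rewrite integral_mkcond -e1 [RHS]integral_mkcond.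
transitivity (\int[pushforward leb (translation s)]_x (((EFin \o g) \_ D) x))%E.
  by rewrite (integral_pushforward (measurable_translation s)).
by apply: eq_measure_integral => A mA _; exact: lebesgue_measure_translation.
Qed.

(** The integral form of [X' = g] almost everywhere on the half-line; each coordinate of a
    trajectory is of this kind. *)
Definition primitive g X := forall t : R, 0 <= t ->
  leb.-integrable `[0, t] (EFin \o g) /\
  X t = X 0 + \int[leb]_(s in `[0, t]) g s.

Lemma primitive_itv g X s t : primitive g X -> 0 <= s -> s <= t ->
  leb.-integrable `[s, t] (EFin \o g) /\
  X t - X s = \int[leb]_(r in `[s, t]) g r.
Proof.
move=> gX s0 st; have t0 := le_trans s0 st.
have [it Xt] := gX t t0; have [is_ Xs] := gX s s0.
have ist : leb.-integrable `[s, t] (EFin \o g).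
  apply: integrableS it => // r /=; rewrite !in_itv/= => /andP[sr ->].
  by rewrite (le_trans s0).
split => //.
rewrite Xt Xs opprD addrACA subrr add0r Rintegral_itvB//.
rewrite Rintegral_itv_obnd_cbnd//.
by apply: integrableS ist => // r /=; rewrite !in_itv/= => /andP[/ltW -> ->].
Qed.

(** The bound on the integrands is asked only before [t], since a concatenation at time [t] follows
    the first input only up to that instant, excluded; the endpoint is a null set. *)
Lemma primitive_lip g k X Y s t (K : R) : primitive g X -> primitive k Y ->
  0 <= s -> s <= t -> (forall r, s <= r < t -> `|g r - k r| <= K) ->
  `|(X t - Y t) - (X s - Y s)| <= K * (t - s).
Proof.
move=> gX kY s0 st gk.
have [ig Xst] := primitive_itv gX s0 st.
have [ik Yst] := primitive_itv kY s0 st.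
have -> : (X t - Y t) - (X s - Y s) = (X t - X s) - (Y t - Y s) by ring.
have igk : leb.-integrable `[s, t] (EFin \o (fun r => g r - k r)).
  have := integrableB _ ig ik; apply => //.
have igo : leb.-integrable `[s, t[ (EFin \o (fun r => g r - k r)).
  by apply: integrableS igk => // r /=; rewrite !in_itv/= => /andP[-> /ltW ->].
rewrite Xst Yst -RintegralB// -Rintegral_itv_bndo_bndc//.
apply: le_trans (le_normr_Rintegral _ igo) _ => //.
have iK : leb.-integrable `[s, t[ (EFin \o cst K).
  have := @continuous_compact_integrable R (cst K) `[s, t] (@segment_compact _ _ _).
  move=> H; apply: integrableS (H _) => //.
    by move=> r /=; rewrite !in_itv/= => /andP[-> /ltW ->].
  by apply: continuous_subspaceT => x; exact: cvg_cst.
apply: (@le_trans _ _ (\int[leb]_(r in `[s, t[) cst K r)); first apply: le_Rintegral => //.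
- by have := integrable_abse igo; apply: eq_integrable.
rewrite Rintegral_cst//= lebesgue_measure_itv/= lte_fin.
case: ifP => [//|]; move=> /negbT; rewrite -leNgt => ts.
have -> : t = s by apply: le_anti; rewrite ts st.
by rewrite /= subrr.
Qed.

Lemma primitive_continuous g X T : primitive g X -> 0 <= T ->
  {within `[0, T], continuous X}.
Proof.
move=> gX T0.
have [iT _] := gX T T0.
have := parameterized_integral_continuous T0 iT.
move=> cI; have cc : {within `[0, T], continuous
  (fun x => X 0 + parameterized_integral leb 0 x g)}.
  by move=> x; apply: cvgD; [exact: cvg_cst|exact: cI].
apply: subspace_eq_continuous cc => x /=; rewrite inE/= in_itv/= => /andP[x0 _].
by rewrite /from_subspace [X in _ = X](proj2 (gX x x0)).
Qed.

Lemma primitive_shift g X s : primitive g X -> 0 <= s ->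
  primitive (fun r => g (r + s)) (fun r => X (r + s)).
Proof.
move=> gX s0 t t0.
have st : s <= t + s by lra.
have [ig Xst] := primitive_itv gX s0 st.
have [] := integral_translation s _ ig => //.
have -> : translation s @^-1` `[s, t + s] = `[0, t]%classic.
  by apply/seteqP; split=> r /=; rewrite /translation !in_itv/= -lerBlDr subrr lerD2r.
by move=> ? ->; split => //; rewrite -Xst add0r addrCA subrr addr0.
Qed.

Definition concat (T : Type) (s : R) (u v : R -> T) : R -> T :=
  fun t => if t < s then u t else v (t - s).

Lemma primitive_concat g X k Y s : primitive g X -> primitive k Y -> 0 <= s ->
  X s = Y 0 -> primitive (concat s g k) (concat s X Y).
Proof.
move=> gX kY s0 XY t t0.
have X0 : concat s X Y 0 = X 0.
  rewrite /concat; case: ltP => // s_le0.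
  have s00 : s = 0 by apply: le_anti; rewrite s0 s_le0.
  by rewrite s00 subrr -XY s00.
rewrite X0.
(* The intervals are half-open because at time [s] the concatenation already follows [k]. *)
have low r : 0 <= r <= s -> leb.-integrable `[0, r[ (EFin \o concat s g k) /\
    \int[leb]_(z in `[0, r[) concat s g k z = X r - X 0.
  move=> /andP[r0 rs]; have [ir Xr] := gX r r0.
  have iro : leb.-integrable `[0, r[ (EFin \o g).
    by apply: integrableS ir => // z /=; rewrite !in_itv/= => /andP[-> /ltW ->].
  have E : {in `[0, r[, concat s g k =1 g}.
    by move=> z; rewrite in_itv/= => /andP[_ zr]; rewrite /concat (lt_le_trans zr rs).
  split.
    apply: eq_integrable iro => // z; rewrite inE/= => zr; rewrite E//.
  transitivity (\int[leb]_(z in `[0, r[) g z).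
    by apply: eq_Rintegral => z; rewrite inE; exact: E.
  by rewrite Rintegral_itv_bndo_bndc// Xr addrC addKr.
have [ts|st] := ltP t s.
  have [|i0 I0] := low t; first by rewrite t0 ltW.
  have it : leb.-integrable `[0, t] (EFin \o concat s g k).
    have [ir _] := gX t t0.
    apply: eq_integrable ir => // z; rewrite inE/= in_itv/= => /andP[_ zt].
    by rewrite /concat (le_lt_trans zt ts).
  split=> //; rewrite -Rintegral_itv_bndo_bndc// I0 /concat ts.
  by rewrite addrC subrK.
have [|i0 I0] := low s; first by rewrite s0 lexx.
have ts0 : 0 <= t - s by rewrite subr_ge0.
have [ik Yk] := kY _ ts0.
have [] := integral_translation (- s) _ ik => //.
have -> : translation (- s) @^-1` `[0, t - s] = `[s, t]%classic.
  by apply/seteqP; split=> r /=; rewrite /translation !in_itv/= lerD2r subr_ge0.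
move=> i1 I1.
have E : {in `[s, t], concat s g k =1 (fun r => k (r - s))}.
  by move=> z; rewrite in_itv/= => /andP[sz _]; rewrite /concat ltNge sz.
have i2 : leb.-integrable `[s, t] (EFin \o concat s g k).
  by apply: eq_integrable i1 => // z; rewrite inE/= => zr; rewrite E.
have U : `[0, t]%classic = `[0, s[%classic `|` `[s, t]%classic :> set R.
  by rewrite -itv_bndbnd_setU// bnd_simp.
have i3 : leb.-integrable `[0, t] (EFin \o concat s g k).
  by rewrite U; apply: integrable_union => //; apply/disj_setPS => y [/=];
    rewrite 2!in_itv/= => /andP[_ ys] /andP[]; rewrite leNgt ys.
split=> //.
rewrite U Rintegral_setU//; last 2 first.
- by rewrite -U.
- by apply/disj_setPS => y [/=]; rewrite 2!in_itv/= => /andP[_ ys] /andP[]; rewrite leNgt ys.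
rewrite I0; transitivity (X 0 + (X s - X 0 + \int[leb]_(r in `[s, t]) k (r - s))); last first.
  by congr (_ + (_ + _)); apply: eq_Rintegral => z; rewrite inE => zst; rewrite E.
rewrite I1 {1}/concat ltNge st/= Yk -XY.
by ring.
Qed.

(** Allows an input to be changed on a null set while the trajectory is kept, as in [traj_clip]. *)
Lemma primitive_ae g k X : primitive g X ->
  (forall T, 0 <= T -> measurable_fun `[0, T] k) ->
  {ae leb, forall t, 0 <= t -> g t = k t} -> primitive k X.
Proof.
move=> gX mk gk t t0; have [it Xt] := gX t t0.
have mg := measurable_int _ it.
have /measurable_EFinP mEk := mk t t0.
split.
  apply/integrableP; split => //.
  have /integrableP[_] := it; congr (_ < _)%E.
  apply: ae_eq_integral => //; [exact: measurableT_comp|exact: measurableT_comp|].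
  case: gk => N [mN N0 sub]; exists N; split => //; apply: subset_trans sub => z /=.
  apply: contra_not => gkz; rewrite in_itv/= => /andP[z0 _].
  by rewrite gkz.
rewrite Xt; congr (_ + _); rewrite /Rintegral; congr fine.
apply: ae_eq_integral => //.
case: gk => N [mN N0 sub]; exists N; split => //; apply: subset_trans sub => z /=.
  apply: contra_not => gkz; rewrite in_itv/= => /andP[z0 _].
by rewrite gkz.
Qed.

End Primitive.

(** * Trajectories *)

Section RowVectorNorms.
Context {R : realType}.

Lemma norm_rV_le k (v : 'rV[R]_k) (c : R) : 0 <= c ->
  (forall i, `|v ord0 i| <= c) -> `|v| <= c.
Proof.
move=> c0 vc; rewrite [leLHS]/Num.norm/= mx_normrE.
by apply/bigmax_leP; split => // -[i j] _ /=; rewrite ord1.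
Qed.

Lemma norm_coord_le k (v : 'rV[R]_k) i : `|v ord0 i| <= `|v|.
Proof.
rewrite [leRHS]/Num.norm/= mx_normrE.
exact: (le_bigmax _ (fun ij : 'I_1 * 'I_k => `|v ij.1 ij.2|) (ord0, i)).
Qed.

Lemma norm_le_eucl k (v : 'rV[R]_k) : `|v| <= eucl v.
Proof.
apply: norm_rV_le => [|i]; first exact: sqrtr_ge0.
rewrite -sqrtr_sqr ler_sqrt; last by apply: sumr_ge0 => j _; exact: sqr_ge0.
by rewrite (bigD1 i)//= lerDl; apply: sumr_ge0 => j _; exact: sqr_ge0.
Qed.

Lemma eucl_le_norm k (v : 'rV[R]_k) : eucl v <= k.+1%:R * `|v|.
Proof.
have v0 : 0 <= k.+1%:R * `|v| by rewrite mulr_ge0.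
rewrite -(ger0_norm v0) -sqrtr_sqr ler_sqrt ?sqr_ge0//.
apply: (@le_trans _ _ (\sum_(i < k) `|v| ^+ 2)).
  apply: ler_sum => i _; rewrite -[leLHS]real_normK ?num_real//.
  by rewrite lerXn2r ?nnegrE// norm_coord_le.
rewrite sumr_const card_ord exprMn -[leLHS]mulr_natl ler_wpM2r ?sqr_ge0//.
rewrite (@le_trans _ _ k.+1%:R)// ?ler_nat//.
by rewrite expr2 ler_peMl// ler1n.
Qed.

Lemma eucl_ge0 k (v : 'rV[R]_k) : 0 <= eucl v.
Proof. exact: sqrtr_ge0. Qed.

Lemma eucl0 k : eucl (0 : 'rV[R]_k) = 0.
Proof.
apply/le_anti; rewrite eucl_ge0 andbT (le_trans (eucl_le_norm _))//.
by rewrite normr0 mulr0.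
Qed.

(** Passes from the Euclidean norm of the hypotheses to the maximum norm of row vectors, in which
    trajectories are estimated. *)
Lemma loclip2_norm n m (f : 'rV[R]_n -> 'rV[R]_m -> 'rV[R]_n) : loclip2 f ->
  forall r : R, exists L : R, 0 < L /\ forall a b c d,
    `|a| <= r -> `|b| <= r -> `|c| <= r -> `|d| <= r ->
    `|f a c - f b d| <= L * (`|a - b| + `|c - d|).
Proof.
move=> fL r; have [L HL] := fL ((n + m).+1%:R * `|r|).
(* The given [L] may be negative, whence [|L| + 1]; the factor [(n + m).+1] compares the two norms
   in both spaces at once. *)
exists ((`|L| + 1) * (n + m).+1%:R); split; first by rewrite mulr_gt0// ltr_wpDl.
have ball k (v : 'rV[R]_k) : (k <= n + m)%N -> `|v| <= r -> eucl v <= (n + m).+1%:R * `|r|.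
  move=> kn vr; apply: le_trans (eucl_le_norm v) _.
  apply: ler_pM => //; first by rewrite ler_nat.
  exact: le_trans vr (ler_norm r).
move=> a b c d ar br cr dr; apply: le_trans (norm_le_eucl _) _.
apply: le_trans (HL a b c d _ _ _ _) _; try by apply: ball => //; rewrite ?leq_addl ?leq_addr.
have e0 := addr_ge0 (eucl_ge0 (a - b)) (eucl_ge0 (c - d)).
apply: (@le_trans _ _ ((`|L| + 1) * (eucl (a - b) + eucl (c - d)))).
  by apply: ler_wpM2r => //; rewrite ler_wpDr// ler_norm.
rewrite -mulrA ler_wpM2l ?addr_ge0// mulrDr.
by apply: lerD; (apply: le_trans (eucl_le_norm _) _;
  rewrite ler_wpM2r// ler_nat ltnS ?leq_addl ?leq_addr).
Qed.

Lemma loclip_norm k l (g : 'rV[R]_k -> 'rV[R]_l) : loclip g ->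
  forall r : R, exists L : R, 0 < L /\ forall a b,
    `|a| <= r -> `|b| <= r -> `|g a - g b| <= L * `|a - b|.
Proof.
move=> gL r; have [L HL] := gL (k.+1%:R * `|r|).
exists ((`|L| + 1) * k.+1%:R); split; first by rewrite mulr_gt0// ltr_wpDl.
have ball (v : 'rV[R]_k) : `|v| <= r -> eucl v <= k.+1%:R * `|r|.
  move=> vr; apply: le_trans (eucl_le_norm v) _.
  by rewrite ler_wpM2l// (le_trans vr (ler_norm r)).
move=> a b ar br; apply: le_trans (norm_le_eucl _) _.
apply: le_trans (HL a b (ball _ ar) (ball _ br)) _.
apply: (@le_trans _ _ ((`|L| + 1) * eucl (a - b))).
  by rewrite ler_wpM2r ?eucl_ge0// ler_wpDr// ler_norm.
by rewrite -mulrA ler_wpM2l ?addr_ge0// eucl_le_norm.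
Qed.

End RowVectorNorms.

(** * A continuity argument on the half-line *)

Section Bootstrap.
Context {R : realType}.
Implicit Types (e : R -> R) (s t T : R).

(** Let [s] be the infimum of the times where [e > c1]. The implication applies at all earlier
    times, so [e s <= c0] by continuity; as [c0 < c1], continuity also keeps [e] below [c1] just
    after [s], a contradiction. *)
Lemma bootstrap e T (c0 c1 : R) :
  (forall t, 0 <= t -> forall eps, 0 < eps -> exists2 del, 0 < del &
     forall s, 0 <= s -> `|s - t| < del -> `|e s - e t| < eps) ->
  c0 < c1 -> e 0 <= c0 ->
  (forall t, 0 <= t <= T -> (forall s, 0 <= s <= t -> e s <= c1) -> e t <= c0) ->
  forall t, 0 <= t <= T -> e t <= c0.
Proof.
move=> ec c01 e0 boot.
suff H t : 0 <= t <= T -> e t <= c1.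
  move=> t /andP[t0 tT]; apply: boot; first by rewrite t0.
  by move=> s /andP[s0 st]; apply: H; rewrite s0 (le_trans st).
move=> /andP[t0 tT]; rewrite leNgt; apply/negP => et.
pose S := [set s | 0 <= s <= t /\ c1 < e s].
have St : S t by rewrite /S/= t0 lexx.
have infS : has_inf S by split; [exists t|exists 0 => s [/andP[]]].
pose s := inf S.
have s0 : 0 <= s by apply: lb_le_inf; [exists t|move=> z [/andP[]]].
have st : s <= t by apply: ge_inf => //; exists 0 => z [/andP[]].
have below z : 0 <= z -> z < s -> e z <= c1.
  move=> z0 zs; rewrite leNgt; apply/negP => ez.
  have : S z by rewrite /S/= z0 (ltW (lt_le_trans zs st)).
  move=> /(ge_inf (proj2 infS)); rewrite leNgt zs//.
have es0 : e s <= c0.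
  have [s00|sp] := eqVneq s 0; first by rewrite s00.
  have {sp}sp : 0 < s by rewrite lt_neqAle eq_sym sp.
  rewrite leNgt; apply/negP => es.
  have [|del del0 Hd] := ec s s0 (e s - c0); first by rewrite subr_gt0.
  pose z := Num.max 0 (s - del / 2).
  have z0 : 0 <= z by rewrite le_max lexx.
  have zs : z < s by rewrite gt_max sp/= ltrBlDr ltrDl divr_gt0.
  have zc : e z <= c0.
    apply: boot; first by rewrite z0 (le_trans (ltW zs) (le_trans st tT)).
    by move=> r /andP[r0 rz]; apply: below => //; exact: le_lt_trans rz zs.
  have := Hd z z0; have : s - del / 2 <= z by rewrite le_max lexx orbT.
  move=> zd; have -> : `|z - s| < del.
    by rewrite ltr0_norm ?subr_lt0//; lra.
  move=> /(_ isT); rewrite ltr_norml => /andP[+ _]; lra.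
have [|del del0 Hd] := ec s s0 (c1 - c0); first by rewrite subr_gt0.
have [z Sz zs] := inf_adherent del0 infS.
have sz : s <= z by apply: ge_inf => //; exact: (proj2 infS).
move: Sz => [/andP[z0 zt] ez].
have := Hd z z0; have -> : `|z - s| < del.
  by rewrite ger0_norm ?subr_ge0// ltrBlDl.
move=> /(_ isT); rewrite ltr_norml => /andP[_]; lra.
Qed.

End Bootstrap.

(* The library equips matrices with a complete and a normed structure, but not
   with their join. *)
HB.instance Definition _ (R : realType) (k l : nat) := NormedModule.on 'M[R]_(k, l).

Section Solutions.
Context {R : realType} {n m : nat}.
Variable f : 'rV[R]_n -> 'rV[R]_m -> 'rV[R]_n.
Implicit Types (xi a b p q : 'rV[R]_n) (u v : R -> 'rV[R]_m) (x y z : R -> 'rV[R]_n).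
Implicit Types (r s t h M T C L : R).

(** Equivalent to [solution], but with the initial value as a separate clause and real-valued
    integrals, so that the facts on [primitive] apply coordinate by coordinate. *)
Definition traj xi u x := x 0 = xi /\
  forall i, primitive (fun s => f (x s) (u s) ord0 i) (fun t => x t ord0 i).

Lemma solutionP xi u x : solution f xi u x <-> traj xi u x.
Proof.
split=> [sol|[x0 px] t t0 i].
  have x0 : x 0 = xi.
    apply/rowP => i; rewrite -[0 : 'I_1]/ord0; have [_] := sol 0 (lexx 0) i.
    by rewrite /itv0 set_itv1 integral_set1 adde0 => -[].
  split=> // i t t0; have [it xt] := sol t t0 i; split=> //.
  apply: EFin_inj; rewrite xt x0 EFinD /Rintegral fineK//.
  by apply: integrable_fin_num.
have [it xt] := px i t t0; split=> //.
rewrite xt x0 EFinD /Rintegral fineK//.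
by apply: integrable_fin_num.
Qed.

Lemma traj_shift xi u x s : traj xi u x -> 0 <= s ->
  traj (x s) (fun t => u (t + s)) (fun t => x (t + s)).
Proof.
move=> [x0 px] s0; split; first by rewrite add0r.
by move=> i; exact: (primitive_shift (px i) s0).
Qed.

Lemma traj_concat xi u x v y s : traj xi u x -> 0 <= s -> traj (x s) v y ->
  traj xi (concat s u v) (concat s x y).
Proof.
move=> [x0 px] s0 [y0 py]; split.
  rewrite /concat; case: ltP => // s_le0.
  have s00 : s = 0 by apply: le_anti; rewrite s0 s_le0.
  by rewrite s00 subrr y0 s00.
move=> i.
have := primitive_concat (px i) (py i) s0; rewrite y0 => /(_ erefl).
congr primitive; apply/funext => t; rewrite /concat; by case: ifP.
Qed.

Lemma concat_self (T : Type) (w : R -> T) s :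
  concat s w (fun t => w (t + s)) = w.
Proof. by apply/funext => t; rewrite /concat subrK; case: ifP. Qed.

Lemma traj_lip xi xi' u u' x x' s t (K : R) : traj xi u x -> traj xi' u' x' ->
  0 <= s -> s <= t -> 0 <= K ->
  (forall r, s <= r < t -> `|f (x r) (u r) - f (x' r) (u' r)| <= K) ->
  `|(x t - x' t) - (x s - x' s)| <= K * (t - s).
Proof.
move=> [_ px] [_ px'] s0 st K0 HK; apply: norm_rV_le => [|i].
  by rewrite mulr_ge0// subr_ge0.
rewrite !mxE; apply: primitive_lip (px i) (px' i) s0 st _ => r rst.
by have := le_trans (norm_coord_le _ i) (HK r rst); rewrite !mxE.
Qed.

Lemma traj_continuous xi u x T : traj xi u x -> 0 <= T ->
  {within `[0, T], continuous x}.
Proof.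
move=> [_ px] T0 t.
have ct i := primitive_continuous (px i) T0.
apply/cvgrPdist_le => /= eps eps0.
have : \forall s \near nbhs (t : subspace `[0, T]), forall i, `|x t ord0 i - x s ord0 i| <= eps.
  apply: filter_forall => i.
  by have /cvgrPdist_le /(_ eps eps0) := ct i t.
apply: filterS => s Hs; apply: norm_rV_le => [|i]; first exact: ltW.
by rewrite !mxE.
Qed.

Lemma traj_continuousP xi u x t eps : traj xi u x -> 0 <= t -> 0 < eps ->
  exists2 del, 0 < del &
    forall s, 0 <= s -> `|s - t| < del -> `|x s - x t| < eps.
Proof.
move=> tx t0 eps0.
have T0 : 0 <= t + 1 by lra.
have tT : `[0, t + 1]%classic t by rewrite /= in_itv/= t0/=; lra.
have := traj_continuous tx T0.
move=> /subspace_continuousP /(_ t tT) /cvgrPdist_lt /(_ eps eps0).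
move=> [d /= d0 Hd]; exists (Num.min d 1); first by rewrite lt_min d0 ltr01.
move=> s s0; rewrite lt_min => /andP[sd s1].
rewrite distrC; apply: Hd => /=; first by rewrite distrC.
rewrite in_itv/= s0/=; move: s1; rewrite ltr_norml; lra.
Qed.

Lemma traj_dist_continuous xi xi' u u' x x' t eps :
  traj xi u x -> traj xi' u' x' -> 0 <= t -> 0 < eps ->
  exists2 del, 0 < del & forall s, 0 <= s -> `|s - t| < del ->
    `| `|x s - x' s| - `|x t - x' t| | < eps.
Proof.
move=> tx tx' t0 eps0; have e20 : 0 < eps / 2 by lra.
have [d d0 Hd] := traj_continuousP tx t0 e20.
have [d' d0' Hd'] := traj_continuousP tx' t0 e20.
exists (Num.min d d'); first by rewrite lt_min d0 d0'.
move=> s s0; rewrite lt_min => /andP[sd sd'].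
apply: le_lt_trans (ler_dist_dist _ _) _.
have -> : x s - x' s - (x t - x' t) = (x s - x t) - (x' s - x' t).
  by apply/rowP => i; rewrite !mxE; ring.
apply: le_lt_trans (ler_normB _ _) _.
have := Hd s s0 sd; have := Hd' s s0 sd'; lra.
Qed.

Lemma traj_bounded xi u x T : traj xi u x -> 0 <= T ->
  exists C, forall t, 0 <= t <= T -> `|x t| <= C.
Proof.
move=> tx T0.
have cx := traj_continuous tx T0.
have := compact_bounded (continuous_compact cx (@segment_compact _ _ _)).
move=> [C [_ HC]]; exists (C + 1) => t tT.
by apply: (HC (C + 1)); [rewrite ltrDl|exists t => //=; rewrite in_itv].
Qed.

(** * Continuous dependence on the initial state *)

Definition lip_on r L := 0 < L /\ forall a b (c d : 'rV[R]_m),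
  `|a| <= r -> `|b| <= r -> `|c| <= r -> `|d| <= r ->
  `|f a c - f b d| <= L * (`|a - b| + `|c - d|).

(** A bootstrap on the distance: as long as it is at most twice its initial value, up to a slack,
    [L * h <= 1/4] lets it grow by at most a half. Hence [x'] need be bounded only while it is near
    [x]. The second conclusion, which says that the flow is close to the identity, feeds the
    contraction in [flow_step]. *)
Lemma track_step xi xi' u u' x x' r L h (eps : R) :
  traj xi u x -> traj xi' u' x' -> lip_on r L -> 0 <= h -> L * h <= 4^-1 -> 0 < eps ->
  (forall t, 0 <= t < h -> u t = u' t /\ `|u t| <= r) ->
  (forall t, 0 <= t <= h -> `|x t| <= r) ->
  (forall t, 0 <= t <= h -> `|x t - x' t| <= 2 * (`|xi - xi'| + eps) -> `|x' t| <= r) ->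
  forall t, 0 <= t <= h -> `|x t - x' t| <= 2 * `|xi - xi'| /\
    `|(x t - x' t) - (xi - xi')| <= L * t * (2 * `|xi - xi'|).
Proof.
move=> tx tx' [L0 lip] h0 Lh eps0 uu xr x'r.
have x0 := proj1 tx; have x0' := proj1 tx'.
have d0 : 0 <= `|xi - xi'| by [].
set d := `|xi - xi'| in d0 x'r *.
have growth c : 0 <= c -> (forall s, 0 <= s <= h -> `|x s - x' s| <= c -> `|x' s| <= r) ->
    forall t, 0 <= t <= h -> (forall s, 0 <= s <= t -> `|x s - x' s| <= c) ->
    `|(x t - x' t) - (xi - xi')| <= L * t * c.
  move=> c0 Hc t /andP[t0 th] xc.
  have -> : L * t * c = (L * c) * (t - 0) by ring.
  rewrite -x0 -x0'; apply: (traj_lip tx tx') => //; first by rewrite mulr_ge0// ltW.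
  move=> s /andP[s0 st].
  have sh : 0 <= s <= h by rewrite s0 (le_trans (ltW st) th).
  have [|us ur] := uu s; first by rewrite s0 (lt_le_trans st th).
  have xsc : `|x s - x' s| <= c by apply: xc; rewrite s0 ltW.
  apply: le_trans (lip _ _ _ _ (xr s sh) (Hc s sh xsc) ur _) _; first by rewrite -us.
  by rewrite -us subrr normr0 addr0 ler_wpM2l// ltW.
(* The slack [eta] keeps the bootstrap thresholds [3 / 2 * (d + eta)] and [2 * (d + eta)] apart even
   when [d = 0]. *)
have bnd (eta : R) : 0 < eta -> eta <= eps -> forall t, 0 <= t <= h ->
    `|x t - x' t| <= 2 * d + 2 * eta.
  move=> eta0 etae.
  have H t : 0 <= t <= h -> `|x t - x' t| <= 3 / 2 * (d + eta).
    apply: (@bootstrap _ (fun t => `|x t - x' t|) h (3 / 2 * (d + eta)) (2 * (d + eta))).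
    - by move=> s s0 e e0; exact: traj_dist_continuous tx tx' s0 e0.
    - by rewrite ltr_pM2r; lra.
    - by rewrite x0 x0' -/d; lra.
    - move=> s /andP[s0 sh] Hs.
      have := growth (2 * (d + eta)); have -> : 0 <= 2 * (d + eta) by lra.
      move=> /(_ isT) G.
      have : `|(x s - x' s) - (xi - xi')| <= L * s * (2 * (d + eta)).
        apply: G => //; last by rewrite s0.
        by move=> z zh xz; apply: x'r => //; lra.
      move=> G2; have := ler_normD ((x s - x' s) - (xi - xi')) (xi - xi').
      rewrite subrK -/d.
      have : L * s * (2 * (d + eta)) <= 4^-1 * (2 * (d + eta)).
        rewrite ler_wpM2r//; first by lra.
        by apply: le_trans Lh; rewrite ler_wpM2l// ltW.
      by lra.
  by move=> t /H; lra.
have bd t : 0 <= t <= h -> `|x t - x' t| <= 2 * d.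
  move=> th; rewrite leNgt; apply/negP => lt_d.
  (* With this [eta] the bound [2 * d + 2 * eta] falls strictly below the distance itself. *)
  pose eta := Num.min eps ((`|x t - x' t| - 2 * d) / 4).
  have eta0 : 0 < eta by rewrite lt_min eps0/=; lra.
  have e1 : eta <= (`|x t - x' t| - 2 * d) / 4 by rewrite ge_min lexx orbT.
  have := bnd eta eta0; rewrite /eta ge_min lexx -/eta => /(_ isT t th).
  by lra.
move=> t th; split; first exact: bd.
apply: growth => //; first by rewrite mulr_ge0.
  by move=> s sh xs; apply: x'r => //; lra.
by move: th => /andP[t0 th] s /andP[s0 st]; apply: bd; rewrite s0 (le_trans st th).
Qed.

(** Each of the [k] short steps at most doubles the distance. The margin [E] can stay fixed in the
    induction, because [2 ^+ k] times the current distance does not increase when a step is taken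
    and [k] drops by one. *)
Lemma track r L h (E : R) k : lip_on r L -> 0 < h -> L * h <= 4^-1 ->
  forall xi xi' u u' x x', traj xi u x -> traj xi' u' x' ->
  2 ^+ k * `|xi - xi'| < E ->
  (forall t, 0 <= t < k%:R * h -> u t = u' t /\ `|u t| <= r) ->
  (forall t, 0 <= t <= k%:R * h -> `|x t| <= r) ->
  (forall t, 0 <= t <= k%:R * h -> `|x t - x' t| <= E -> `|x' t| <= r) ->
  forall t, 0 <= t <= k%:R * h -> `|x t - x' t| <= 2 ^+ k * `|xi - xi'|.
Proof.
move=> lip h0 Lh; elim: k => [|k IH] xi xi' u u' x x' tx tx' dE uu xr x'r t.
  rewrite mul0r => /le_anti <-.
  by rewrite (proj1 tx) (proj1 tx') expr0 mul1r.
have d0 : 0 <= `|xi - xi'| by [].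
set d := `|xi - xi'| in d0 dE *.
have p1 : 1 <= 2 ^+ k :> R by rewrite exprn_ege1// ler1n.
have dd : 2 * d <= 2 ^+ k.+1 * d by rewrite exprS -mulrA ler_wpM2l// ler_peMl.
have kh0 : 0 <= k%:R * h by rewrite mulr_ge0// ltW.
have kS : k.+1%:R * h = h + k%:R * h by rewrite -natr1; ring.
have hk : h <= k.+1%:R * h by rewrite kS lerDl.
have st1 s : 0 <= s <= h -> `|x s - x' s| <= 2 * d.
  (* This slack makes the confinement radius [2 * (d + eps)] of [track_step] equal to [E]. *)
  have := @track_step xi xi' u u' x x' r L h ((E - 2 * d) / 2) tx tx' lip (ltW h0) Lh.
  move=> H sh; apply: (H _ _ _ _ s sh).1; first by lra.
  - by move=> z /andP[z0 zh]; apply: uu; rewrite z0 (lt_le_trans zh hk).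
  - by move=> z /andP[z0 zh]; apply: xr; rewrite z0 (le_trans zh hk).
  - move=> z /andP[z0 zh]; rewrite -/d => xz; apply: x'r; first by rewrite z0 (le_trans zh hk).
    by lra.
move=> /andP[t0 tk].
have [th|ht] := leP t h.
  by apply: le_trans dd; apply: st1; rewrite t0.
have hh : 0 <= h <= h by rewrite lexx ltW.
have d'd := st1 h hh.
have := IH _ _ _ _ _ _ (traj_shift tx (ltW h0)) (traj_shift tx' (ltW h0)).
have d'E : 2 ^+ k * `|x h - x' h| <= 2 ^+ k.+1 * d.
  by rewrite exprSr -mulrA ler_wpM2l// exprn_ge0.
move=> /(_ (le_lt_trans d'E dE)) H.
have {H} := H _ _ _ (t - h); rewrite subrK => H.
apply: le_trans d'E; apply: H.
- by move=> s /andP[s0 sk]; apply: uu; lra.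
- by move=> s /andP[s0 sk]; apply: xr; lra.
- by move=> s /andP[s0 sk]; apply: x'r; lra.
- lra.
Qed.

Hypothesis f_lip : forall r, exists L, lip_on r L.

Lemma track_unif r T : 0 < T -> exists2 A, 0 < A &
  forall (E : R) xi xi' u u' x x', traj xi u x -> traj xi' u' x' ->
  A * `|xi - xi'| < E ->
  (forall t, 0 <= t < T -> u t = u' t /\ `|u t| <= r) ->
  (forall t, 0 <= t <= T -> `|x t| <= r) ->
  (forall t, 0 <= t <= T -> `|x t - x' t| <= E -> `|x' t| <= r) ->
  forall t, 0 <= t <= T -> `|x t - x' t| <= A * `|xi - xi'|.
Proof.
move=> T0; have [L lip] := f_lip r.
have L0 := proj1 lip.
(* Enough steps for [L * (T / k) <= 1/4]; the constant [2 ^+ k] does not depend on the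
   trajectories. *)
pose k := (Num.trunc (L * T * 4)).+1.
have kL : L * T * 4 <= k%:R by rewrite ltW// truncnS_gt.
have k0 : 0 < k%:R :> R by rewrite ltr0n.
exists (2 ^+ k); first by rewrite exprn_gt0.
move=> E xi xi' u u' x x' tx tx' dE uu xr x'r t tT.
have hT : k%:R * (T / k%:R) = T by rewrite mulrC divfK// gt_eqF.
apply: (@track r L (T / k%:R) E k lip _ _ xi xi' u u' x x') => //; rewrite ?hT//.
  by rewrite divr_gt0.
by rewrite mulrA ler_pdivrMr//; lra.
Qed.

Lemma gronwall r T : 0 < T -> exists2 A, 0 < A &
  forall xi xi' u x x', traj xi u x -> traj xi' u x' ->
  (forall t, 0 <= t < T -> `|u t| <= r) ->
  (forall t, 0 <= t <= T -> `|x t| <= r) ->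
  (forall t, 0 <= t <= T -> `|x' t| <= r) ->
  forall t, 0 <= t <= T -> `|x t - x' t| <= A * `|xi - xi'|.
Proof.
move=> T0; have [A A0 HA] := track_unif r T0.
exists A => // xi xi' u x x' tx tx' ur xr x'r.
apply: (HA (A * `|xi - xi'| + 1) _ _ u u) => //; first by rewrite ltrDl.
  by move=> t tT; split=> //; exact: ur.
by move=> t tT _; exact: x'r.
Qed.

(** Here [x'] has no bound given in advance: a close enough start keeps it within distance 1 of [x],
    hence in the ball of radius [r + 1]. *)
Lemma stay_close r T : 0 < T -> exists2 A, 0 < A &
  forall xi xi' u u' x x', traj xi u x -> traj xi' u' x' ->
  A * `|xi - xi'| < 1 ->
  (forall t, 0 <= t < T -> u t = u' t /\ `|u t| <= r) ->
  (forall t, 0 <= t <= T -> `|x t| <= r) ->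
  forall t, 0 <= t <= T -> `|x t - x' t| <= A * `|xi - xi'|.
Proof.
move=> T0; have [A A0 HA] := track_unif (r + 1) T0.
exists A => // xi xi' u u' x x' tx tx' A1 ur xr.
apply: (HA 1 _ _ u u') => // t tT.
- by have [-> +] := ur t tT; split=> //; lra.
- by have := xr t tT; lra.
- move=> xx; have := xr t tT; have := ler_normB (x t) (x t - x' t).
  by rewrite subKr; lra.
Qed.

Hypothesis f00 : f 0 0 = 0.

Lemma traj0 : traj 0 (fun=> 0) (fun=> 0).
Proof.
split=> // i t t0.
have -> : (fun s : R => f 0 0 ord0 i) = cst 0 by apply/funext => s; rewrite f00 mxE.
split; first exact: integrable0.
by rewrite !mxE add0r /Rintegral integral0.
Qed.

(** The bound holds at every instant and measurability on the whole line, so that shifts and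
    concatenations involve no null sets; [traj_clip] reduces general inputs to these. *)
Definition adm M u := (forall j, measurable_fun setT (fun t => u t ord0 j)) /\
  forall t, eucl (u t) <= M.

Lemma adm_norm M u t : adm M u -> `|u t| <= M.
Proof. by move=> [_ uM]; exact: le_trans (norm_le_eucl _) (uM t). Qed.

Lemma adm_ge0 M u : adm M u -> 0 <= M.
Proof. by move=> [_ /(_ 0)]; apply: le_trans; exact: eucl_ge0. Qed.

Lemma adm_ess M u : adm M u -> ess_bounded u M.
Proof. by move=> [_ uM]; exact: aeW. Qed.

Lemma adm_input M u : adm M u -> input u.
Proof.
move=> [mu uM]; split=> [j|T]; first exact: measurable_funTS.
by exists M; exact: aeW.
Qed.

Lemma adm_cst0 : adm 0 (fun=> 0).
Proof.
split=> [j|t]; last by rewrite eucl0.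
by under eq_fun do rewrite mxE; exact: measurable_cst.
Qed.

Lemma adm_le M M' u : M <= M' -> adm M u -> adm M' u.
Proof. by move=> MM' [mu uM]; split=> // t; exact: le_trans MM'. Qed.

Lemma adm_shift M u s : adm M u -> adm M (fun t => u (t + s)).
Proof.
move=> [mu uM]; split=> // j.
by apply: (measurableT_comp (mu j)); exact: measurable_translation.
Qed.

Lemma adm_concat M u v s : adm M u -> adm M v -> adm M (concat s u v).
Proof.
move=> [mu uM] [mv vM]; split=> [j|t]; last by rewrite /concat; case: ifP.
have -> : (fun t => concat s u v t ord0 j) =
    (fun t => if t < s then u t ord0 j else v (t - s) ord0 j).
  by apply/funext => t; rewrite /concat; case: ifP.
apply: measurable_fun_ifT => //; first exact: measurable_fun_ltr.
by apply: (measurableT_comp (mv j)); exact: (measurable_translation (- s)).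
Qed.

(** Comparison with the zero trajectory bounds the speed by [L * (r + r)] inside the ball of radius
    [r], and a bootstrap shows that the trajectory stays there. The time [h] depends on the input
    and the start only through [M] and [c]. *)
Lemma small_time (c M : R) : exists2 h, 0 < h & forall u, adm M u ->
  forall xi x, traj xi u x -> `|xi| <= c -> forall t, 0 <= t <= h -> `|x t| <= c + 1.
Proof.
pose r : R := `|c| + 1 + `|M|.
have [L [L0 lip]] := f_lip r.
exists (2 * (L * (r + r) + 1))^-1.
  rewrite invr_gt0 mulr_gt0// ltr_wpDl// mulr_ge0// ?ltW// /r.
  by have := normr_ge0 c; have := normr_ge0 M; lra.
have r0 : 0 <= r by rewrite /r; have := normr_ge0 c; have := normr_ge0 M; lra.
set h := (2 * _)^-1.
have Lr0 : 0 <= L * (r + r) by rewrite mulr_ge0 ?addr_ge0// ltW.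
have hL : L * (r + r) * h <= 2^-1.
  by rewrite /h ler_pdivrMr; lra.
move=> u um xi x tx xc.
have x0 := proj1 tx.
have H : forall t, 0 <= t <= h -> `|x t - xi| <= 2^-1.
  apply: (@bootstrap _ (fun t => `|x t - xi|) h 2^-1 1).
  - move=> t t0 e e0.
    have [d d0 Hd] := traj_continuousP tx t0 e0; exists d => // s s0 st.
    apply: le_lt_trans (ler_dist_dist _ _) _.
    have -> : x s - xi - (x t - xi) = x s - x t by rewrite opprB addrA subrK.
    exact: Hd.
  - by lra.
  - by rewrite x0 subrr normr0; lra.
  - move=> t /andP[t0 th] xt.
    have := traj_lip tx traj0 (lexx 0) t0 Lr0.
    rewrite x0 !subr0 => H.
    apply: (@le_trans _ _ (L * (r + r) * t)); last by apply: le_trans hL; rewrite ler_wpM2l.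
    apply: H => s /andP[s0 st].
    have xsr : `|x s| <= r.
      have := xt s; rewrite s0 (ltW st) => /(_ isT); have := ler_normD (x s - xi) xi.
      rewrite subrK /r; have := ler_norm c; have := normr_ge0 M; lra.
    have usr : `|u s| <= r.
      by have := adm_norm s um; rewrite /r; have := ler_norm M; have := normr_ge0 c; lra.
    apply: le_trans (lip _ _ _ _ _ _ _ _) _; rewrite ?normr0//.
    by rewrite !subr0; apply: ler_wpM2l; [exact: ltW|exact: lerD].
move=> t /H; have := ler_normD (x t - xi) xi; rewrite subrK; lra.
Qed.

(** * Local surjectivity of the flow *)

Hypothesis f_complete : forall M u xi, adm M u -> exists x, traj xi u x.

(* The short-time flow is the identity plus a contraction, hence locally onto. *)
Lemma flow_step (c M : R) : exists2 h, 0 < h & forall u, adm M u ->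
  forall b x, traj b u x -> `|b| <= c -> forall t, 0 <= t <= h ->
  forall p, `|p - x t| <= 4^-1 ->
  exists b' x', [/\ traj b' u x', `|b' - b| <= 2 * `|p - x t| & x' t = p].
Proof.
have [h1 h10 H1] := small_time (c + 1) M.
pose r : R := `|c| + 3 + `|M|.
have [L lip] := f_lip r; have L0 := proj1 lip.
exists (Num.min h1 (4 * L)^-1).
  by rewrite lt_min h10 invr_gt0 mulr_gt0.
move=> u um b x tx bc t /andP[t0]; rewrite le_min => /andP[th1 thL] p px.
have Lt : L * t <= 4^-1.
  apply: (@le_trans _ _ (L * (4 * L)^-1)); first by rewrite ler_wpM2l// ltW.
  by rewrite invfM mulrCA divff ?mulr1// gt_eqF.
have ur s : `|u s| <= r.
  by have := adm_norm s um; rewrite /r; have := ler_norm M; have := normr_ge0 c; lra.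
have yr q y : traj q u y -> `|q| <= c + 1 -> forall s, 0 <= s <= t -> `|y s| <= r.
  move=> ty qc s /andP[s0 st].
  have := H1 u um q y ty qc s; rewrite s0 (le_trans st th1) => /(_ isT).
  by rewrite /r; have := ler_norm c; have := normr_ge0 M; lra.
have lipF q q' y y' : traj q u y -> traj q' u y' -> `|q| <= c + 1 -> `|q'| <= c + 1 ->
    `|(y t - y' t) - (q - q')| <= 2^-1 * `|q - q'|.
  move=> ty ty' qc qc'.
  have := @track_step q q' u u y y' r L t 1 ty ty' lip t0 Lt ltr01.
  move=> /(_ _ _ _ t) [].
  - by move=> s _; split.
  - exact: yr ty qc.
  - by move=> s st _; exact: yr ty' qc' _ st.
  - by rewrite t0 lexx.
  move=> _ H; apply: le_trans H _; rewrite mulrA ler_wpM2r//; lra.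
(* [F q] is some trajectory from [q]; that [F b] agrees with [x] at time [t] is uniqueness, which is
   [lipF] with equal initial states. *)
have [F HF] := choice (fun q => f_complete q um).
have Fb : F b t = x t.
  have bc1 : `|b| <= c + 1 by lra.
  have := lipF b b _ _ (HF b) tx bc1 bc1.
  by rewrite subrr normr0 mulr0 subr0 normr_le0 subr_eq0 => /eqP.
(* A fixed point of [G] starts a trajectory that is at [p] at time [t]. [G] contracts by 1/2 and
   maps the ball [U] of radius 1/2 into itself, as 1/2 * 1/2 + 1/4 = 1/2. *)
pose G (q : 'rV[R]_n) : 'rV[R]_n := q + (p - F q t).
pose U := [set q : 'rV[R]_n | `|b - q| <= 2^-1].
have Ucl : closed U by exact: (@closed_closed_ball_ _ 'rV[R]_n b 2^-1).
have Uc q : U q -> `|q| <= c + 1.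
  by rewrite /U/= => bq; have := ler_normB b (b - q); rewrite subKr; lra.
have Gd q q' : U q -> U q' -> `|G q - G q'| <= 2^-1 * `|q - q'|.
  move=> Uq Uq'; rewrite -normrN.
  have -> : - (G q - G q') = (F q t - F q' t) - (q - q').
    by rewrite /G; apply/rowP => i; rewrite !mxE; ring.
  by apply: lipF => //; exact: Uc.
have Ub : U b by rewrite /U/= subrr normr0; lra.
have Gb : G b - b = p - x t by rewrite /G Fb addrAC subrr add0r.
have tri q : `|G q - b| <= `|G q - G b| + `|p - x t|.
  by rewrite -Gb; have := ler_normD (G q - G b) (G b - b); rewrite addrA subrK.
have GU : {homo G : q / U q >-> U q}.
  move=> q Uq; have := Gd q b Uq Ub.
  move: (Uq); rewrite /U/= => bq.
  have := tri q.
  by rewrite [`|b - G q|]distrC [`|q - b|]distrC; lra.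
have ctr : is_contraction (mkfun GU).
  have h2 : (0 : R) <= 2^-1 by lra.
  exists (NngNum h2); split=> /=; first by lra.
  by move=> [q q'] [/= Uq Uq']; exact: Gd.
have [|q Uq qG] := banach_fixed_point ctr Ucl.
  by exists b.
have {}qG : q = G q by [].
exists q, (F q); split; first exact: HF.
  by have := Gd q b Uq Ub; have := tri q; rewrite -qG; lra.
move: qG; rewrite /G -[LHS]addr0 => /addrI /esym /eqP.
by rewrite subr_eq0 => /eqP.
Qed.

(** [[0, s]] is cut into steps short enough for [flow_step] and treated backwards: the start that
    the later steps require becomes the target of the first step. *)
Lemma flow_open M u a x s (eps : R) : adm M u -> traj a u x -> 0 <= s -> 0 < eps ->
  exists2 del, 0 < del & forall p, `|p - x s| < del ->
  exists a' x', [/\ traj a' u x', `|a' - a| < eps & x' s = p].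
Proof.
move=> um tx s0 eps0.
have [C HC] := traj_bounded tx s0.
have [h0 h00 step] := flow_step C M.
have [k [h [sk h_ge0 hh0]]] : exists (k : nat) h, [/\ s = k%:R * h, 0 <= h & h <= h0].
  pose k := (Num.trunc (s / h0)).+1.
  have k0 : 0 < k%:R :> R by rewrite ltr0n.
  exists k, (s / k%:R); split; first by rewrite mulrC divfK// gt_eqF.
    by rewrite divr_ge0.
  by rewrite ler_pdivrMr// mulrC -ler_pdivrMr// ltW// truncnS_gt.
rewrite sk in HC *; clear sk.
elim: k => [|k IH] in u a x eps um tx eps0 HC *.
  exists eps => // p; rewrite mul0r (proj1 tx) => pa.
  by have [x' tx'] := f_complete p um; exists p, x'; split=> //; exact: (proj1 tx').
have kh0 : 0 <= k%:R * h by rewrite mulr_ge0.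
have kS : k.+1%:R * h = k%:R * h + h by rewrite -natr1; ring.
(* [flow_step] reaches targets within 1/4 and moves the start by at most twice the error, so an
   error of [eps / 3] is affordable. *)
pose e1 := Num.min 4^-1 (eps / 3).
have e10 : 0 < e1 by rewrite lt_min; apply/andP; split; lra.
have [|del del0 Hdel] := IH _ _ _ e1 (adm_shift h um) (traj_shift tx h_ge0) e10.
  by move=> t /andP[t0 tk]; apply: HC; rewrite kS; lra.
exists del => // p; rewrite kS => /Hdel[p1 [y [ty p1x yp]]].
have [|||a' [x' [tx' a'a x'h]]] := step u um a x tx _ h _ p1.
- by have := HC 0; rewrite (proj1 tx); apply; rewrite lexx kS addr_ge0.
- by rewrite h_ge0.
- by apply: ltW; apply: lt_le_trans p1x _; rewrite ge_min lexx.
exists a', (concat h x' y); split.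
- rewrite -(concat_self u h); apply: traj_concat => //; by rewrite x'h.
- apply: le_lt_trans a'a _.
  have : e1 <= eps / 3 by rewrite ge_min lexx orbT.
  by lra.
- by rewrite /concat ltNge lerDr kh0/= addrK.
Qed.

End Solutions.

(** * Bounded reachable sets *)

(** Bolzano-Weierstrass, phrased by frequent visits to neighbourhoods, so that no subsequence has to
    be carried along. *)
Lemma bounded_cluster (R : realType) n (w : nat -> 'rV[R]_n) (C : R) :
  (forall k, `|w k| <= C) ->
  exists p, forall e, 0 < e -> forall N, exists k, (N <= k)%N /\ `|w k - p| < e.
Proof.
move=> wC.
pose A := [set q : 'rV[R]_n | `|0 - q| <= C].
have Acl : closed A by exact: (@closed_closed_ball_ _ 'rV[R]_n 0 C).
have Ab : bounded_set A.
  exists C; split; first exact: num_real.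
  by move=> D CD q; rewrite /A/= sub0r normrN => /le_trans; apply; exact: ltW.
have Ac := bounded_closed_compact Ab Acl.
have [|p [_ pc]] := Ac (w @ \oo) _.
  by exists 0%N => // k _ /=; rewrite /A/= sub0r normrN.
exists p => e e0 N.
have FN : (w @ \oo) (w @` [set k | (N <= k)%N]).
  by exists N => // k /= Nk; exists k.
have [_ [[k Nk <-]]] := pc _ _ FN (nbhsx_ballx p e e0).
by rewrite -ball_normE/= distrC => H; exists k.
Qed.

Section BoundedReach.
Context {R : realType} {n m : nat}.
Variable f : 'rV[R]_n -> 'rV[R]_m -> 'rV[R]_n.
Hypothesis f_lip : forall r : R, exists L : R, lip_on f r L.
Hypothesis f00 : f 0 0 = 0.
Hypothesis f_complete : forall (M : R) u xi, adm M u -> exists x, traj f xi u x.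
Variable M : R.
Implicit Types (p q xi a : 'rV[R]_n) (u v : R -> 'rV[R]_m) (x y z : R -> 'rV[R]_n).
Implicit Types (s t tau h C : R).

(** Trajectories from near [p] have no uniform bound up to time [tau]. The start varies with [C] and
    [del], so no single trajectory need be unbounded. *)
Definition escaping p tau := forall C del, 0 < del -> exists xi u x t,
  [/\ `|xi - p| < del, adm M u, traj f xi u x, 0 <= t <= tau & C < `|x t|].

Lemma escaping_seq p tau (c : R) : escaping p tau ->
  exists (xi : nat -> 'rV[R]_n) (u : nat -> R -> 'rV[R]_m)
    (x : nat -> R -> 'rV[R]_n) (t : nat -> R), forall k,
  [/\ `|xi k - p| < k.+1%:R^-1, adm M (u k), traj f (xi k) (u k) (x k),
      0 <= t k <= tau & c + k%:R < `|x k (t k)|].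
Proof.
move=> ep.
have /choice[F HF] : forall k : nat, exists w : 'rV[R]_n * (R -> 'rV[R]_m) * (R -> 'rV[R]_n) * R,
  [/\ `|w.1.1.1 - p| < k.+1%:R^-1, adm M w.1.1.2, traj f w.1.1.1 w.1.1.2 w.1.2,
      0 <= w.2 <= tau & c + k%:R < `|w.1.2 w.2|].
  move=> k; have [|xi [u [x [t H]]]] := ep (c + k%:R) k.+1%:R^-1.
    by rewrite invr_gt0 ltr0n.
  by exists (xi, u, x, t).
by exists (fun k => (F k).1.1.1), (fun k => (F k).1.1.2), (fun k => (F k).1.2), (fun k => (F k).2).
Qed.

Lemma inv_succ_lt (e : R) : 0 < e -> exists N, forall k, (N <= k)%N -> k.+1%:R^-1 < e.
Proof.
move=> e0; exists (Num.trunc e^-1).+1 => k Nk.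
rewrite -[e]invrK ltf_pV2 ?posrE ?invr_gt0 ?ltr0n//.
by apply: lt_le_trans (truncnS_gt _) _; rewrite ler_nat (leq_trans Nk).
Qed.

(** Up to time [h] the escaping trajectories are still bounded, so their positions at [h] have a
    cluster point [p'], and their remaining pieces show that [p'] escapes in time [tau - h]. By
    [flow_step] one of the starts can be moved so as to hit [p'] exactly. The threshold [h0] depends
    on [p] only through [c], which later bounds the step lengths from below. *)
Lemma escaping_step (c : R) : exists2 h0, 0 < h0 & forall h, 0 < h -> h <= h0 ->
  forall p, `|p| <= c -> forall tau, escaping p tau ->
  forall eps : R, 0 < eps -> exists v a z,
  [/\ adm M v, `|a - p| < eps, traj f a v z & escaping (z h) (tau - h)].
Proof.
have [h1 h10 H1] := small_time f_lip f00 (c + 1) M.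
have [h2 h20 H2] := flow_step f_lip f00 f_complete (c + 1) M.
exists (Num.min h1 h2); first by rewrite lt_min h10.
move=> h h0; rewrite le_min => /andP[hh1 hh2] p pc tau ep eps eps0.
have c0 : 0 <= c by apply: le_trans pc.
(* A norm above [c + 2] puts every escape later than [h], since [small_time] keeps the states within
   [c + 2] until then. *)
have [xi [u [x [t Hk]]]] := escaping_seq (c + 2) ep.
have xic k : `|xi k| <= c + 1.
  have [xip _ _ _ _] := Hk k; have := ler_normD (xi k - p) p; rewrite subrK.
  have : `|xi k - p| <= 1.
    by apply: le_trans (ltW xip) _; rewrite invf_le1 ?ltr0n// ler1n.
  by lra.
have xhc k s : 0 <= s <= h -> `|x k s| <= c + 2.
  move=> /andP[s0 sh]; have [_ uk tk _ _] := Hk k.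
  have := H1 _ uk _ _ tk (xic k) s; rewrite s0 (le_trans sh hh1) => /(_ isT).
  by lra.
have th k : h < t k.
  have [_ _ _ /andP[tk0 _] xt] := Hk k; rewrite ltNge; apply/negP => tkh.
  have := xhc k (t k); rewrite tk0 tkh => /(_ isT); have : 0 <= k%:R :> R by [].
  by lra.
have hh : 0 <= h <= h by rewrite lexx ltW.
have [p' clp] := bounded_cluster (fun k => xhc k h hh).
have ep' : escaping p' (tau - h).
  move=> C del del0.
  have [k [Ck kp]] := clp del del0 (Num.trunc `|C|).+1.
  have [_ uk tk /andP[tk0 tkt] xt] := Hk k.
  exists (x k h), (fun s => u k (s + h)), (fun s => x k (s + h)), (t k - h); split => //.
  - exact: adm_shift.
  - exact: traj_shift tk (ltW h0).
  - by rewrite subr_ge0 ltW//= lerB.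
  - rewrite subrK; apply: le_lt_trans xt.
    have : `|C| < k%:R by apply: lt_le_trans (truncnS_gt _) _; rewrite ler_nat.
    have := ler_norm C; lra.
have [N HN] := inv_succ_lt (divr_gt0 eps0 (ltr0n R 2)).
(* The error doubles in [flow_step] and so contributes less than [eps / 2]; the distance from [xi k]
   to [p] accounts for the other half. *)
have e40 : 0 < Num.min 4^-1 (eps / 4) by rewrite lt_min; apply/andP; split; lra.
have [k [Nk kp]] := clp _ e40 N.
have kp1 : `|p' - x k h| <= 4^-1.
  by rewrite distrC; apply: ltW; apply: lt_le_trans kp _; rewrite ge_min lexx.
have kp2 : `|p' - x k h| < eps / 4.
  by rewrite distrC; apply: lt_le_trans kp _; rewrite ge_min lexx orbT.
have [xip uk tk _ _] := Hk k.
have := H2 _ uk _ _ tk (xic k) h; rewrite (ltW h0) hh2 => /(_ isT p' kp1).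
move=> [a [z [tz axi zh]]].
exists (u k), a, z; split=> //; last by rewrite zh.
have := ler_normD (a - xi k) (xi k - p); rewrite addrA subrK.
have := lt_trans xip (HN k Nk); lra.
Qed.

Lemma escaping_time p tau : escaping p tau -> 0 <= tau.
Proof.
move=> /(_ 0 1 ltr01)[xi [u [x [t [_ _ _ /andP[t0 tt] _]]]]].
exact: le_trans tt.
Qed.

(** Running minima of the thresholds work, because [P k] survives any decrease of [h]. *)
Lemma antitone_choice (P : nat -> R -> Prop) :
  (forall k, exists2 h0, 0 < h0 & forall h, 0 < h -> h <= h0 -> P k h) ->
  exists H : nat -> R, forall k, [/\ 0 < H k, P k (H k) & forall j, (k <= j)%N -> H j <= H k].
Proof.
move=> HP.
have /choice[G HG] : forall k, exists h0, 0 < h0 /\ forall h, 0 < h -> h <= h0 -> P k h.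
  by move=> k; have [h0] := HP k; exists h0.
pose H := fix H k := if k is k'.+1 then Num.min (G k) (H k') else G 0%N.
have H0 k : 0 < H k.
  by elim: k => [|k IH] /=; rewrite ?lt_min ?IH ?andbT; exact: (HG _).1.
have HGk k : H k <= G k by case: k => [|k] //=; rewrite ge_min lexx.
exists H => k; split=> //; first exact: (HG k).2.
elim=> [|j IH]; first by rewrite leqn0 => /eqP ->.
rewrite leq_eqVlt => /predU1P[->//|/IH]; apply: le_trans.
by rewrite /= ge_min lexx orbT.
Qed.

(** * Step-by-step construction of a blow-up *)

Record stage := Stage { st_a : 'rV[R]_n; st_u : R -> 'rV[R]_m;
  st_x : R -> 'rV[R]_n; st_s : R; st_eps : R }.

Definition stage_ok (T : R) (S : stage) := [/\ adm M (st_u S),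
  traj f (st_a S) (st_u S) (st_x S), 0 <= st_s S,
  escaping (st_x S (st_s S)) (T - st_s S) & 0 < st_eps S].

(** Halved tolerances make the initial states converge, to a limit within [2 * st_eps S'] of
    [st_a S]. The last clause is stated for that radius, so that it applies to the trajectory from
    the limit. *)
Definition stage_next (H : nat -> R) (S S' : stage) :=
  [/\ st_eps S' <= st_eps S / 2,
      `|st_a S' - st_a S| < st_eps S',
      forall t, t < st_s S -> st_u S' t = st_u S t,
      st_s S' = st_s S + H (Num.trunc `|st_x S (st_s S)|).+1 &
      forall b v y, `|b - st_a S| <= 2 * st_eps S' -> traj f b v y ->
        (forall t, 0 <= t < st_s S -> st_u S t = v t) ->
        `|y (st_s S) - st_x S (st_s S)| <= 1].

(* [a'] is chosen, by openness of the flow, so that the new trajectory passes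
   at time [s] exactly through the start point supplied by [escaping_step]. *)
Lemma stage_extend (T : R) (H : nat -> R) (S : stage) :
  (forall k, 0 < H k /\ forall p, `|p| <= k%:R -> forall tau, escaping p tau ->
    forall eps : R, 0 < eps -> exists v a z,
    [/\ adm M v, `|a - p| < eps, traj f a v z & escaping (z (H k)) (tau - H k)]) ->
  stage_ok T S -> exists S', stage_ok T S' /\ stage_next H S S'.
Proof.
case: S => a U x s eps HH [/= uU tx s0 ep eps0].
have [C HC] := traj_bounded tx s0.
(* The case [s = 0] is apart because [stay_close] needs a positive time; otherwise [e <= A^-1 / 4]
   bounds the deviation by 1/2. *)
have [e [e0 [ee close]]] : exists e, 0 < e /\ e <= eps / 2 /\
    forall b v y, `|b - a| <= 2 * e -> traj f b v y ->
        (forall t, 0 <= t < s -> U t = v t) -> `|y s - x s| <= 1.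
  have [s00|sp] := eqVneq s 0.
    exists (Num.min (eps / 2) 4^-1); split; first by rewrite lt_min; apply/andP; split; lra.
    split; first by rewrite ge_min lexx.
    move=> b v y ba ty _; rewrite s00 (proj1 ty) (proj1 tx); apply: le_trans ba _.
    have : Num.min (eps / 2) 4^-1 <= 4^-1 by rewrite ge_min lexx orbT.
    by lra.
  have {sp}sp : 0 < s by rewrite lt_neqAle eq_sym sp.
  have [A A0 HA] := stay_close f_lip (Num.max C M) sp.
  exists (Num.min (eps / 2) (A^-1 / 4)).
  have A40 : 0 < A^-1 / 4 by rewrite divr_gt0// invr_gt0.
  split; first by rewrite lt_min A40 andbT; lra.
  split; first by rewrite ge_min lexx.
  move=> b v y ba ty Uv.
  have Ab : A * `|a - b| <= 2^-1.
    have : Num.min (eps / 2) (A^-1 / 4) <= A^-1 / 4 by rewrite ge_min lexx orbT.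
    move=> m4; rewrite distrC -ler_pdivlMl//; lra.
  rewrite distrC; apply: le_trans (HA a b U v x y tx ty _ _ _ s _) _.
  - lra.
  - move=> t ts; split; first exact: Uv.
    by rewrite le_max (adm_norm _ uU) orbT.
  - by move=> t /HC; rewrite le_max => ->.
  - by rewrite s0 lexx.
  - lra.
have [del del0 Hdel] := flow_open f_lip f00 f_complete uU tx s0 e0.
set k := (Num.trunc `|x s|).+1.
have xk : `|x s| <= k%:R by rewrite ltW// truncnS_gt.
have [Hk0 Hk] := HH k.
have [v [a1 [z [adv a1x tz epz]]]] := Hk _ xk _ ep del del0.
have [a' [x' [tx' aa' x's]]] := Hdel a1 a1x.
exists (Stage a' (concat s U v) (concat s x' z) (s + H k) e); split.
  split=> //=.
  - exact: adm_concat.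
  - by apply: traj_concat => //; rewrite x's.
  - by rewrite addr_ge0// ltW.
  - rewrite /concat ltNge lerDl (ltW Hk0)/= opprD addrA.
    by rewrite [s + _]addrC addrK.
by split=> //= t ts; rewrite /concat ts.
Qed.

(** The initial states of the stages converge to [as_] and their inputs fit together into [v]. The
    trajectory [y] from [as_] under [v] exists for all times, is bounded on [[0, T]], and is within
    1 of stage [j] at time [s j <= T]. So the stage positions are bounded, the step lengths have a
    positive lower bound, and [s j] must exceed [T]. *)
Lemma no_escaping p T : ~ escaping p T.
Proof.
move=> ep.
have [H HH] : exists H : nat -> R, forall k, [/\ 0 < H k,
    forall p, `|p| <= k%:R -> forall tau, escaping p tau ->
    forall eps : R, 0 < eps -> exists v a z,
    [/\ adm M v, `|a - p| < eps, traj f a v z & escaping (z (H k)) (tau - H k)]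
    & forall j, (k <= j)%N -> H j <= H k].
  apply: (@antitone_choice (fun k h => forall p, `|p| <= k%:R ->
    forall tau, escaping p tau -> forall eps : R, 0 < eps -> exists v a z,
    [/\ adm M v, `|a - p| < eps, traj f a v z & escaping (z h) (tau - h)])) => k.
  have [h0 h00 Hh0] := escaping_step k%:R.
  exists h0 => // h hp hh p pk tau; exact: Hh0.
have [u0 [x0 [tx0 u0M]]] : exists u x, traj f p u x /\ adm M u.
  have [xi [u [x [t [_ uM _ _ _]]]]] := ep 0 1 ltr01.
  by have [y ty] := f_complete p uM; exists u, y.
pose S0 := Stage p u0 x0 0 1.
have ok0 : stage_ok T S0.
  by split=> //=; rewrite (proj1 tx0) subr0.
(* Dependent choice: stages are packed with their invariant, so that [nxt] can be iterated. *)
have /choice[nxt Hnxt] : forall S : {S | stage_ok T S}, exists S' : {S | stage_ok T S},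
    stage_next H (sval S) (sval S').
  move=> [S okS].
  have HH' k := let: And3 Hk0 Hk _ := HH k in conj Hk0 Hk.
  have [S' [okS' SS']] := stage_extend HH' okS.
  by exists (exist _ S' okS').
pose S j := sval (iter j nxt (exist _ S0 ok0)).
have okS j : stage_ok T (S j) by exact: svalP.
have nextS j : stage_next H (S j) (S j.+1) by exact: Hnxt.
pose a j := st_a (S j). pose u j := st_u (S j). pose x j := st_x (S j).
pose s j := st_s (S j). pose e j := st_eps (S j).
have uM j : adm M (u j) by have [] := okS j.
have s0 j : 0 <= s j by have [] := okS j.
have sT j : s j <= T by have [_ _ _ /escaping_time + _] := okS j; rewrite subr_ge0.
have e0 j : 0 < e j by have [] := okS j.
have sS j : s j < s j.+1.
  have [_ _ _ sE _] := nextS j; rewrite /s sE ltrDl.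
  by have [] := HH (Num.trunc `|st_x (S j) (st_s (S j))|).+1.
have smono j k : (j <= k)%N -> s j <= s k.
  elim: k => [|k IH]; first by rewrite leqn0 => /eqP ->.
  by rewrite leq_eqVlt => /predU1P[->//|/IH]/le_trans; apply; exact: ltW.
have uconst j k t : (j <= k)%N -> t < s j -> u k t = u j t.
  elim: k => [|k IH]; first by rewrite leqn0 => /eqP ->.
  rewrite leq_eqVlt => /predU1P[->//|jk] ts.
  have [_ _ uu _ _] := nextS k; rewrite -(IH jk ts); apply: uu.
  exact: lt_le_trans ts (smono j k jk).
(* The term [2 * e] pays for the whole remaining tail of halving tolerances, which makes the
   estimate inductive. *)
have adist j k : `|a (j + k)%N - a j| + 2 * e (j + k).+1 <= 2 * e j.+1.
  elim: k => [|k IH]; first by rewrite addn0 subrr normr0 add0r.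
  have [ee _ _ _ _] := nextS (j + k).+1; have [_ aa _ _ _] := nextS (j + k)%N.
  move: ee aa; rewrite addnS -/(a _) -/(a _) -/(e _) -/(e _) => ee aa.
  have := ler_normD (a (j + k).+1 - a (j + k)%N) (a (j + k)%N - a j).
  by rewrite addrA subrK; lra.
have [as_ Has] : exists as_, forall j, `|as_ - a j| <= 2 * e j.+1.
  have [|as_ Has] := @bounded_cluster _ _ a (`|a 0%N| + 2 * e 1%N).
    move=> k; have := adist 0%N k; have := e0 k.+1; rewrite add0n.
    by have := ler_normD (a k - a 0%N) (a 0%N); rewrite subrK; lra.
  exists as_ => j; apply/ler_addgt0Pr => d d0.
  have [k [jk kas]] := Has d d0 j.
  have := adist j (k - j)%N; rewrite subnKC// => ad; have := e0 k.+1.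
  have := ler_normD (as_ - a k) (a k - a j); rewrite addrA subrK [`|as_ - _|]distrC.
  by lra.
(* From the supremum of the [s j] on, [v] takes the default value 0. *)
pose v t := xget 0 [set w | exists j, t < s j /\ w = u j t].
have vE j t : t < s j -> v t = u j t.
  move=> ts; rewrite /v; case: xgetP => [w _ [k [tk ->]]|/(_ (u j t))[]]; last by exists j.
  by have [jk|/ltnW kj] := leqP j k; [exact: uconst|rewrite -(uconst k j)].
have vM : adm M v.
  split=> [i|t].
    (* These truncations are eventually constant in [j] at every instant, so measurability passes to
       their limit [v]. *)
    pose w j t := if t < s j then u j t ord0 i else 0.
    apply: (@measurable_fun_cvg _ _ _ _ w) => //.
      move=> j; apply: measurable_fun_ifT => //; first exact: measurable_fun_ltr.
      by have [] := uM j.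
    move=> t _; apply: cvg_near_cst.
    have [[j tj]|nj] := pselect (exists j, t < s j).
      exists j => // k /= jk; have tk := lt_le_trans tj (smono _ _ jk).
      by rewrite /w tk (vE k).
    apply: nearW => k; rewrite /w ifF; last by apply/negP => tk; apply: nj; exists k.
    by rewrite /v xgetPN ?mxE// => y [j [tj _]]; apply: nj; exists j.
  rewrite /v; case: xgetP => [w _ [j [_ ->]]|_]; first by have [] := uM j.
  by rewrite eucl0 (adm_ge0 (uM 0%N)).
have [y ty] := f_complete as_ vM.
have T0 : 0 <= T := le_trans (s0 0%N) (sT 0%N).
have [C HC] := traj_bounded ty T0.
have xC j : `|x j (s j)| <= C + 1.
  have [_ _ _ _ close] := nextS j.
  have : `|y (s j) - x j (s j)| <= 1.
    by apply: (close as_ v y (Has j) ty) => t /andP[_ ts]; rewrite (vE j).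
  have := HC (s j); rewrite s0 sT => /(_ isT).
  have := ler_normB (y (s j)) (y (s j) - x j (s j)); rewrite subKr.
  by lra.
(* Every index at which [H] is evaluated by a stage is at most [K]; as [H] is nonincreasing, each
   step lasts at least [H K]. *)
pose K := (Num.trunc (C + 1)).+1.
have [HK0 _ _] := HH K.
have sK j : j%:R * H K <= s j.
  elim: j => [|j IH]; first by rewrite mul0r.
  have [_ _ _ sE _] := nextS j.
  have [_ _ HKle] := HH (Num.trunc `|x j (s j)|).+1.
  have : H K <= H (Num.trunc `|x j (s j)|).+1.
    by apply: HKle; rewrite ltnS; apply: le_truncn; exact: xC.
  rewrite /s sE -/(s j) -/(x j) -natr1 mulrDl mul1r; lra.
have := truncnS_gt (T / H K); rewrite ltr_pdivrMr// => TK.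
have := le_lt_trans (le_trans (sK _) (sT (Num.trunc (T / H K)).+1)) TK.
by rewrite ltxx.
Qed.

(** Without a bound there is, for each integer, a start in the ball whose trajectory exceeds it by
    time [T]; a cluster point of these starts is escaping. *)
Lemma bounded_reach (r T : R) : exists C : R, forall xi u x t,
  `|xi| <= r -> adm M u -> traj f xi u x -> 0 <= t <= T -> `|x t| <= C.
Proof.
apply: contrapT => nC.
have esc C : exists w : 'rV[R]_n * (R -> 'rV[R]_m) * (R -> 'rV[R]_n) * R,
    [/\ `|w.1.1.1| <= r, adm M w.1.1.2, traj f w.1.1.1 w.1.1.2 w.1.2,
      0 <= w.2 <= T & C < `|w.1.2 w.2|].
  apply: contrapT => nw; apply: nC; exists C => xi u x t xr uM tx tT.
  by rewrite leNgt; apply/negP => Cx; apply: nw; exists (xi, u, x, t).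
have /choice[F HF] := fun k : nat => esc k%:R.
have [|p clp] := @bounded_cluster _ _ (fun k => (F k).1.1.1) r.
  by move=> k; have [] := HF k.
apply: (@no_escaping p T) => C del del0.
have [k [Ck kp]] := clp del del0 (Num.trunc `|C|).+1.
have [xr uM tx tT xt] := HF k.
exists (F k).1.1.1, (F k).1.1.2, (F k).1.2, (F k).2; split=> //.
apply: lt_trans xt; apply: le_lt_trans (ler_norm C) _.
by apply: lt_le_trans (truncnS_gt _) _; rewrite ler_nat.
Qed.

End BoundedReach.

(** * Comparison functions *)

Section ComparisonFunctions.
Context {R : realType}.
Implicit Types (g k chi : R -> R) (b : R -> R -> R) (s t c eps del : R).

Lemma within_continuousP (A : set R) g : {within A, continuous g} <->
  forall t, A t -> forall eps, 0 < eps -> exists2 del, 0 < del &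
    forall s, A s -> `|s - t| < del -> `|g s - g t| < eps.
Proof.
split=> [/subspace_continuousP cg t At eps eps0|H].
  have /cvgrPdist_lt /(_ _ eps0) [del /= del0 Hd] := cg t At.
  exists del => // s As st; rewrite distrC; apply: Hd => //=.
  by rewrite distrC.
apply/subspace_continuousP => t At; apply/cvgrPdist_lt => eps eps0.
have [del del0 Hd] := H t At eps eps0.
by exists del => //= s /= st As; rewrite distrC; apply: Hd => //; rewrite distrC.
Qed.

Lemma classK_le g s t : classK g -> 0 <= s -> s <= t -> g s <= g t.
Proof.
move=> [_ [_ gm]] s0; rewrite le_eqVlt => /predU1P[->//|st].
by apply: ltW; exact: gm.
Qed.

Lemma classK_ge0 g s : classK g -> 0 <= s -> 0 <= g s.
Proof. by move=> gK s0; rewrite -(proj1 gK); exact: classK_le. Qed.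

Lemma classK_continuousP g t eps : classK g -> 0 <= t -> 0 < eps ->
  exists2 del, 0 < del & forall s, 0 <= s -> `|s - t| < del -> `|g s - g t| < eps.
Proof.
move=> [_ [/within_continuousP gc _]] t0 eps0.
have [|del del0 Hd] := gc t _ eps eps0; first by rewrite /= in_itv/= t0.
by exists del => // s s0; apply: Hd; rewrite /= in_itv/= s0.
Qed.

Lemma classKI g : g 0 = 0 ->
  (forall t eps, 0 <= t -> 0 < eps -> exists2 del, 0 < del &
    forall s, 0 <= s -> `|s - t| < del -> `|g s - g t| < eps) ->
  (forall s t, 0 <= s -> s < t -> g s < g t) -> classK g.
Proof.
move=> g0 gc gm; split=> //; split=> //; apply/within_continuousP.
move=> t /=; rewrite in_itv/= andbT => t0 eps eps0.
have [del del0 Hd] := gc t eps t0 eps0.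
by exists del => // s; rewrite in_itv/= andbT; exact: Hd.
Qed.

Lemma classK_comp_scale g k c : 0 < c -> classK g -> classK k ->
  classK (fun s => g (c * k s)).
Proof.
move=> c0 gK kK; apply: classKI.
- by rewrite (proj1 kK) mulr0 (proj1 gK).
- move=> t eps t0 eps0.
  have kt0 := classK_ge0 kK t0.
  have ckt0 : 0 <= c * k t by rewrite mulr_ge0// ltW.
  have [d1 d10 H1] := classK_continuousP gK ckt0 eps0.
  have d1c : 0 < d1 / c by rewrite divr_gt0.
  have [d2 d20 H2] := classK_continuousP kK t0 d1c.
  exists d2 => // s s0 st; apply: H1.
    by rewrite mulr_ge0 ?(ltW c0)//; exact: classK_ge0.
  by rewrite -mulrBr normrM gtr0_norm// mulrC -ltr_pdivlMr//; exact: H2.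
- move=> s t s0 st; apply: (proj2 (proj2 gK)).
    by rewrite mulr_ge0 ?(ltW c0)//; exact: classK_ge0.
  by rewrite ltr_pM2l//; exact: (proj2 (proj2 kK)).
Qed.

Lemma classKL_ge0 b s t : classKL b -> 0 <= s -> 0 <= t -> 0 <= b s t.
Proof. by move=> [bK _] s0 t0; apply: (classK_ge0 (g := b^~ t)) => //; exact: bK. Qed.

Lemma classKL_small b s eps : classKL b -> 0 <= s -> 0 < eps ->
  exists2 T, 0 < T & forall t, T <= t -> b s t < eps.
Proof.
move=> [_ bt] s0 eps0; have [_ /cvgrPdist_lt /(_ _ eps0)] := bt s s0.
move=> [N [_ HN]]; exists (Num.max 1 (N + 1)); first by rewrite lt_max ltr01.
move=> t; rewrite ge_max => /andP[t1 Nt].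
have := HN t; rewrite sub0r normrN => H; apply: le_lt_trans (ler_norm _) (H _).
by apply: lt_le_trans Nt; rewrite ltrDl.
Qed.

Lemma classKL_comp_scale g b c : 0 < c -> classK g -> classKL b ->
  classKL (fun s t => g (c * b s t)).
Proof.
move=> c0 gK bKL; split=> [t t0|s s0].
  by apply: classK_comp_scale => //; exact: (proj1 bKL).
split=> [t1 t2 t10 t12|].
  apply: classK_le => //.
    by rewrite mulr_ge0 ?(ltW c0)//; apply: classKL_ge0 => //; exact: le_trans t12.
  by rewrite ler_pM2l//; exact: (proj1 (proj2 bKL s s0)).
apply/cvgrPdist_lt => eps eps0.
have [d d0 Hd] := classK_continuousP gK (lexx 0) eps0.
have dc : 0 < d / c by rewrite divr_gt0.
have [T T0 HT] := classKL_small bKL s0 dc.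
exists T; split; first exact: num_real.
move=> t Tt; have t0 : 0 <= t := le_trans (ltW T0) (ltW Tt).
have cb0 : 0 <= c * b s t by rewrite mulr_ge0 ?(ltW c0)//; exact: classKL_ge0.
have := Hd _ cb0; rewrite (proj1 gK) !subr0 sub0r normrN; apply.
by rewrite ger0_norm// mulrC -ltr_pdivlMr// HT// ltW.
Qed.

Lemma classK_id : classK (fun s => s).
Proof.
apply: classKI => // t eps t0 eps0; by exists eps.
Qed.

Lemma classK_add_id g : classK g -> classK (fun s => g s + s).
Proof.
move=> gK; apply: classKI => [|t eps t0 eps0|s t s0 st].
- by rewrite (proj1 gK) addr0.
- have e20 : 0 < eps / 2 by lra.
  have [d d0 Hd] := classK_continuousP gK t0 e20.
  exists (Num.min d (eps / 2)); first by rewrite lt_min d0.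
  move=> s s0; rewrite lt_min => /andP[sd se].
  rewrite opprD addrACA; apply: le_lt_trans (ler_normD _ _) _.
  by have := Hd s s0 sd; lra.
- by apply: ltrD => //; exact: (proj2 (proj2 gK)).
Qed.

(** Surjectivity comes from the intermediate value theorem, and continuity of the inverse from
    strict monotonicity of both functions. *)
Lemma classKinf_inv g : classKinf g -> exists k, [/\ classK k,
  forall s, 0 <= s -> k (g s) = s & forall s, 0 <= s -> g (k s) = s].
Proof.
move=> [gK gu].
have gm s t : 0 <= s -> s < t -> g s < g t by exact: (proj2 (proj2 gK)).
have surj s : exists z, 0 <= s -> 0 <= z /\ g z = s.
  have [s0|s0] := leP 0 s; last by exists 0.
  have [z [z0 sz]] := gu s.
  have cz : {within `[0, z], continuous g}.
    apply/within_continuousP => t /=; rewrite in_itv/= => /andP[t0 _] eps eps0.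
    have [d d0 Hd] := classK_continuousP gK t0 eps0.
    by exists d => // r /=; rewrite in_itv/= => /andP[r0 _]; exact: Hd.
  have [|y] := @IVT _ g 0 z s z0 cz.
    by rewrite (proj1 gK) ge_min s0/= le_max sz orbT.
  by rewrite in_itv/= => /andP[y0 _] gy; exists y.
have /choice[k Hk] := surj.
have k0 s : 0 <= s -> 0 <= k s by move=> /Hk[].
have gk s : 0 <= s -> g (k s) = s by move=> /Hk[].
have kg s : 0 <= s -> k (g s) = s.
  move=> s0; have gs0 := classK_ge0 gK s0.
  have [lt|lt|//] := ltgtP (k (g s)) s.
    by have := gm _ _ (k0 _ gs0) lt; rewrite gk// ltxx.
  by have := gm _ _ s0 lt; rewrite gk// ltxx.
have km s t : 0 <= s -> s < t -> k s < k t.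
  move=> s0 st; have t0 := le_trans s0 (ltW st).
  rewrite ltNge; apply/negP => /(classK_le gK (k0 _ t0)).
  by rewrite !gk// leNgt st.
exists k; split=> //; apply: classKI => //.
  by rewrite -[X in k X](proj1 gK) kg.
move=> t eps t0 eps0.
have kt0 := k0 t t0.
have up : t < g (k t + eps) by rewrite -[ltLHS]gk//; apply: gm => //; rewrite ltrDl.
(* When [k t - eps] is negative the lower estimate is automatic, and [g] is not known to be monotone
   there. *)
have [lo|lo] := leP 0 (k t - eps).
  have dn : g (k t - eps) < t by rewrite -[ltRHS]gk//; apply: gm => //; rewrite gtrBl.
  exists (Num.min (g (k t + eps) - t) (t - g (k t - eps))).
    by rewrite lt_min !subr_gt0 up.
  move=> s s0; rewrite lt_min => /andP[su sd].
  have su' : s < g (k t + eps) by move: su; rewrite ltr_norml; lra.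
  have sd' : g (k t - eps) < s by move: sd; rewrite ltr_norml; lra.
  have := km _ _ s0 su'; rewrite kg; last by lra.
  have := km _ _ (classK_ge0 gK lo) sd'; rewrite kg//.
  by rewrite ltr_norml; lra.
exists (g (k t + eps) - t); first by rewrite subr_gt0.
move=> s s0 su.
have su' : s < g (k t + eps) by move: su; rewrite ltr_norml; lra.
have := km _ _ s0 su'; rewrite kg; last by lra.
have := k0 s s0; rewrite ltr_norml; lra.
Qed.

End ComparisonFunctions.

(** * A function of class K_infinity that is flat at the origin *)

Section Flattening.
Context {R : realType}.
Variable c : nat -> R.
Hypothesis c01 : forall k, 0 < c k <= 1.
Implicit Types (s t : R).

Definition hinge k s : R := Num.max (s - k.+1%:R^-1) 0.

(* [hinge k] vanishes up to [1 / (k + 1)], so the weight [c k] only has to tame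
   what happens above that level. *)
Definition flatten_at s := sup [set z | exists k, z = c k * hinge k s].

Lemma hinge_ge0 k s : 0 <= hinge k s.
Proof. by rewrite le_max lexx orbT. Qed.

Lemma hinge_le k s : 0 <= s -> hinge k s <= s.
Proof. by move=> s0; rewrite ge_max s0 andbT gerBl invr_ge0. Qed.

Lemma flatten_has_sup s : 0 <= s -> has_sup [set z | exists k, z = c k * hinge k s].
Proof.
move=> s0; split; first by exists (c 0%N * hinge 0 s); exists 0%N.
exists s => _ [k ->]; have /andP[ck0 ck1] := c01 k.
apply: le_trans (hinge_le k s0).
by rewrite ler_piMl// hinge_ge0.
Qed.

Lemma flatten_ge k s : 0 <= s -> c k * hinge k s <= flatten_at s.
Proof. by move=> s0; apply: sup_upper_bound; [exact: flatten_has_sup|exists k]. Qed.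

Lemma flatten_le s (B : R) : 0 <= s -> (forall k, c k * hinge k s <= B) ->
  flatten_at s <= B.
Proof.
move=> s0 HB; apply: ge_sup; first exact: (proj1 (flatten_has_sup s0)).
by move=> _ [k ->].
Qed.

Lemma flatten_ge0 s : 0 <= s -> 0 <= flatten_at s.
Proof.
move=> s0; apply: le_trans (flatten_ge 0 s0).
by rewrite mulr_ge0 ?hinge_ge0//; have /andP[/ltW] := c01 0%N.
Qed.

Lemma flatten_lip s t (B : R) : 0 <= s -> 0 <= t -> 0 <= B ->
  (forall k, c k * (hinge k s - hinge k t) <= B) -> flatten_at s <= flatten_at t + B.
Proof.
move=> s0 t0 B0 HB; apply: flatten_le => // k.
by have := flatten_ge k t0; have := HB k; rewrite mulrBr; lra.
Qed.

Lemma hinge_lip k s t : hinge k s - hinge k t <= `|s - t|.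
Proof.
rewrite lerBlDr ge_max; apply/andP; split.
  have : t - k.+1%:R^-1 <= hinge k t by rewrite le_max lexx.
  by have := ler_norm (s - t); move: (hinge k t) (k.+1%:R^-1) => ? ?; lra.
by rewrite addr_ge0// hinge_ge0.
Qed.

Lemma flatten_lip1 s t : 0 <= s -> 0 <= t -> flatten_at s <= flatten_at t + `|s - t|.
Proof.
move=> s0 t0; apply: flatten_lip => // k.
have /andP[ck0 ck1] := c01 k; apply: le_trans (_ : c k * `|s - t| <= _).
  by rewrite ler_pM2l// hinge_lip.
by rewrite ler_piMl.
Qed.

Lemma flatten_pos s : 0 < s -> 0 < flatten_at s.
Proof.
move=> s0; have [N HN] := inv_succ_lt s0.
apply: lt_le_trans (flatten_ge N (ltW s0)).
have /andP[cN0 _] := c01 N; rewrite mulr_gt0// lt_max subr_gt0 HN//.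
Qed.

(** Weights at most 1 make the supremum 1-Lipschitz. Each hinge is convex and vanishes at 0, so
    [flatten_at s <= s / t * flatten_at t] for [s < t], and positivity of [flatten_at t] gives
    strictness. Unboundedness comes from the term [k = 0], which is [c 0 * (s - 1)] for [s >= 1]. *)
Lemma classKinf_flatten : classKinf flatten_at.
Proof.
split.
  apply: classKI.
  - apply: le_anti; rewrite flatten_ge0// andbT; apply: flatten_le => // k.
    have -> : hinge k 0 = 0; last by rewrite mulr0.
    by apply/max_idPr; rewrite sub0r oppr_le0 invr_ge0.
  - move=> t eps t0 eps0; exists eps => // s s0 st.
    have := flatten_lip1 s0 t0; have := flatten_lip1 t0 s0.
    rewrite [`|t - s|]distrC ltr_norml; lra.
  - move=> s t s0 st; have t0 := le_lt_trans s0 st.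
    have ft := flatten_pos t0.
    apply: (@le_lt_trans _ _ (s / t * flatten_at t)); last first.
      by rewrite gtr_pMl// ltr_pdivrMr// mul1r.
    apply: flatten_le => // k.
    apply: (@le_trans _ _ (s / t * (c k * hinge k t))); last first.
      by rewrite ler_wpM2l ?divr_ge0 ?(ltW t0)//; apply: flatten_ge; exact: ltW.
    have /andP[ck0 _] := c01 k.
    rewrite mulrCA ler_pM2l// ge_max; apply/andP; split; last first.
      by rewrite mulr_ge0 ?divr_ge0 ?hinge_ge0 ?(ltW t0).
    apply: (@le_trans _ _ (s / t * (t - k.+1%:R^-1))).
      rewrite mulrBr divfK ?gt_eqF// lerD2l lerN2 ler_piMl ?invr_ge0//.
      by rewrite ler_pdivrMr// mul1r ltW.
    by rewrite ler_wpM2l ?divr_ge0 ?(ltW t0)// le_max lexx.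
move=> A; have /andP[c00 _] := c01 0%N.
exists (`|A| / c 0%N + 1); have A0 : 0 <= `|A| / c 0%N by rewrite divr_ge0// ltW.
split; first by rewrite addr_ge0.
have s0 : 0 <= `|A| / c 0%N + 1 by rewrite addr_ge0.
apply: le_trans (flatten_ge 0 s0); apply: le_trans (ler_norm A) _.
apply: (@le_trans _ _ (c 0%N * (`|A| / c 0%N))); first by rewrite mulrC divfK// gt_eqF.
by rewrite ler_pM2l// le_max invr1 addrK lexx.
Qed.

End Flattening.

(** * The envelope *)

Section Clipping.
Context {R : realType} {n m : nat}.
Variable f : 'rV[R]_n -> 'rV[R]_m -> 'rV[R]_n.
Hypothesis f_lip : forall r : R, exists L : R, lip_on f r L.
Notation leb := (@lebesgue_measure R).

(** With a negative [M], the exceptional null set would contain [[0, 1]]. *)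
Lemma ess_bounded_ge0 (u : R -> 'rV[R]_m) (M : R) : ess_bounded u M -> 0 <= M.
Proof.
move=> [N [mN N0 uN]]; rewrite leNgt; apply/negP => M0.
have sub : `[0, 1]%classic `<=` N.
  move=> t /=; rewrite in_itv/= => /andP[t0 _]; apply: uN => /= /(_ t0).
  by move=> /(le_trans (eucl_ge0 _)); rewrite leNgt M0.
have : (leb `[0%R, 1%R]%classic <= leb N)%E by apply: le_measure => //; rewrite inE.
by rewrite [X in (_ <= X)%E]N0 lebesgue_measure_itv/= lte_fin ltr01 oppr0 adde0 lee_fin ler10.
Qed.

(** The input is set to zero at negative times and wherever it exceeds [M], which on the half-line
    changes it only on a null set. *)
Lemma traj_clip xi (u : R -> 'rV[R]_m) x (M : R) :
  input u -> traj f xi u x -> ess_bounded u M ->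
  exists2 v, adm M v & traj f xi v x.
Proof.
move=> [mu _] tx uM; have M0 := ess_bounded_ge0 uM.
pose w t : 'rV[R]_m := if 0 <= t then u t else 0.
have mw j : measurable_fun setT (fun t => w t ord0 j).
  have -> : (fun t => w t ord0 j) = (fun t => u t ord0 j) \_ `[0, +oo[.
    apply/funext => t; rewrite /patch /w mem_setE in_itv/= andbT.
    by case: ifP => // _; rewrite mxE.
  have mI : measurable (`[0, +oo[%classic : set R) by exact: measurable_itv.
  exact: (measurable_restrictT _ mI).1 (mu j).
pose b t := \sum_(j < m) w t ord0 j ^+ 2 <= M ^+ 2.
have mb : measurable_fun setT b.
  apply: measurable_fun_ler => //; apply: measurable_sum => j.
  exact: measurable_funX.
have bE t : b t = (eucl (w t) <= M).
  by rewrite /b -[in RHS](ger0_norm M0) -sqrtr_sqr ler_sqrt// sqr_ge0.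
pose v t : 'rV[R]_m := if b t then w t else 0.
exists v.
  split=> [j|t]; last by rewrite /v bE; case: ifP => // _; rewrite eucl0.
  have -> : (fun t => v t ord0 j) = (fun t => if b t then w t ord0 j else 0).
    by apply/funext => t; rewrite /v; case: ifP => // _; rewrite mxE.
  exact: measurable_fun_ifT.
have [x0 px] := tx; split=> // i; apply: primitive_ae (px i) _ _.
  move=> T T0.
  (* The new integrand is measurable because it is either [f (x s) (u s)], which is integrable, or
     [f (x s) 0], which is continuous in [s]. *)
  have E : {in `[0, T]%classic, (fun s => if b s then f (x s) (u s) ord0 i else f (x s) 0 ord0 i)
      =1 (fun s => f (x s) (v s) ord0 i)}.
    move=> s; rewrite inE/= in_itv/= => /andP[s0 _].
    by rewrite /v /w s0; case: ifP.
  apply: (eq_measurable_fun _ E).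
  have mT : measurable (`[0, T]%classic : set R) by exact: measurable_itv.
  apply: measurable_fun_if => //; first exact: measurable_funTS.
    apply: (@measurable_funS _ _ _ _ `[0, T]) => //.
    have [it _] := px i T T0.
    by apply/measurable_EFinP; exact: (measurable_int leb).
  apply: (@measurable_funS _ _ _ _ `[0, T]) => //.
  apply: subspace_continuous_measurable_fun => //.
  apply/within_continuousP => t /=; rewrite in_itv/= => /andP[t0 tT] eps eps0.
  have [C HC] := traj_bounded tx T0.
  have [L [L0 lip]] := f_lip `|C|.
  have [d d0 Hd] := traj_continuousP tx t0 (divr_gt0 eps0 L0).
  exists d => // s; rewrite in_itv/= => /andP[s0 sT] st.
  have := norm_coord_le (f (x s) 0 - f (x t) 0) i; rewrite !mxE; move/le_lt_trans; apply.
  have xC r : 0 <= r <= T -> `|x r| <= `|C| by move=> /HC /le_trans; apply; exact: ler_norm.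
  apply: le_lt_trans (lip _ _ _ _ (xC s _) (xC t _) _ _) _; rewrite ?s0 ?t0 ?normr0//.
  by rewrite subrr normr0 addr0 mulrC -ltr_pdivlMr// Hd.
case: uM => N [mN N0 sub]; exists N; split => //; apply: subset_trans sub => t /=.
apply: contra_not => ut t0; have := ut t0.
by rewrite /v bE /w t0 => ->.
Qed.

End Clipping.

(** * The output envelope: behaviour along trajectories and regularity *)

Section OutputEnvelope.
Context {R : realType} {n m p : nat}.
Variables (f : 'rV[R]_n -> 'rV[R]_m -> 'rV[R]_n) (h : 'rV[R]_n -> 'rV[R]_p).
Hypothesis f_lip : forall r : R, exists L : R, lip_on f r L.
Hypothesis f00 : f 0 0 = 0.
Hypothesis f_complete : forall (M : R) u xi, adm M u -> exists x, traj f xi u x.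
Hypothesis h_lip : loclip h.
Variables (beta : R -> R -> R) (gam : R -> R).
Hypothesis betaKL : classKL beta.
Hypothesis gamK : classK gam.
Hypothesis gam_ge : forall s : R, 0 <= s -> s <= gam s.
Hypothesis ios : forall (M : R) xi u x t, adm M u -> traj f xi u x -> 0 <= t ->
  `|h (x t)| <= beta (eucl xi) t + gam M.

(** Of the two copies of [gam M], one cancels the gain in [ios], and the other confines the inputs
    that matter to a bounded range. *)
Definition excess xi : set R := [set e | exists M u x t,
  [/\ adm M u, traj f xi u x, 0 <= t & e = `|h (x t)| - 2 * gam M]].

Definition envelope xi := sup (excess xi).

Lemma excess_output xi : excess xi `|h xi|.
Proof.
have [x tx] := f_complete xi (@adm_cst0 R m).
exists 0, (fun=> 0), x, 0; split=> //; first exact: adm_cst0.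
by rewrite (proj1 gamK) mulr0 subr0 (proj1 tx).
Qed.

Lemma excess_le xi e : excess xi e -> e <= beta (eucl xi) 0.
Proof.
move=> [M [u [x [t [uM tx t0 ->]]]]].
have g0 := classK_ge0 gamK (adm_ge0 uM).
have := ios uM tx t0.
have := proj1 (proj2 betaKL _ (eucl_ge0 xi)) 0 t (lexx 0) t0.
by lra.
Qed.

Lemma excess_has_sup xi : has_sup (excess xi).
Proof.
split; first by exists `|h xi|; exact: excess_output.
by exists (beta (eucl xi) 0) => e; exact: excess_le.
Qed.

Lemma excess_le_envelope xi e : excess xi e -> e <= envelope xi.
Proof. by apply: sup_upper_bound; exact: excess_has_sup. Qed.

Lemma envelope_le xi (B : R) : (forall e, excess xi e -> e <= B) -> envelope xi <= B.
Proof. by apply: ge_sup; exact: (proj1 (excess_has_sup xi)). Qed.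

Lemma norm_output_le_envelope xi : `|h xi| <= envelope xi.
Proof. by apply: excess_le_envelope; exact: excess_output. Qed.

Lemma envelope_ge0 xi : 0 <= envelope xi.
Proof. exact: le_trans (norm_output_le_envelope xi). Qed.

Lemma envelope0 : envelope 0 = 0.
Proof.
apply: le_anti; rewrite envelope_ge0 andbT; apply: envelope_le => e /excess_le.
by rewrite eucl0 (proj1 (proj1 betaKL 0 (lexx 0))).
Qed.

(* Every pair (input, time) from [x t] extends, by concatenation with [u], to
   one from [xi]; splitting [gam (max M M')] absorbs the extra input. *)
Lemma envelope_traj M xi u x t : adm M u -> traj f xi u x -> 0 <= t ->
  envelope (x t) <= envelope xi + 2 * gam M /\
  envelope (x t) <= beta (eucl xi) t + gam M.
Proof.
move=> uM tx t0.
have key M' v y s : adm M' v -> traj f (x t) v y -> 0 <= s ->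
    exists w z, [/\ adm (Num.max M M') w, traj f xi w z, z (t + s) = y s &
      gam (Num.max M M') <= gam M + gam M'].
  move=> vM ty s0; exists (concat t u v), (concat t x y); split.
  - apply: adm_concat; [apply: adm_le uM|apply: adm_le vM]; by rewrite le_max lexx ?orbT.
  - exact: traj_concat.
  - by rewrite /concat ltNge lerDl s0/= addrC addKr.
  - have g0 := classK_ge0 gamK (adm_ge0 uM); have g0' := classK_ge0 gamK (adm_ge0 vM).
    by rewrite maxEle; case: ifP => _; lra.
split; apply: envelope_le => _ [M' [v [y [s [vM ty s0 ->]]]]];
  have [w [z [wM tz zE gM]]] := key _ _ _ _ vM ty s0; have ts0 := addr_ge0 t0 s0.
  have : excess xi (`|h (z (t + s))| - 2 * gam (Num.max M M')).
    by exists (Num.max M M'), w, z, (t + s).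
  by move=> /excess_le_envelope; rewrite zE; lra.
have := ios wM tz ts0; rewrite zE.
have tts : t <= t + s by rewrite lerDl.
have := proj1 (proj2 betaKL _ (eucl_ge0 xi)) t (t + s) t0 tts.
by have := classK_ge0 gamK (adm_ge0 vM); lra.
Qed.

(* Only bounded times and inputs contribute where the envelope exceeds [eps],
   and the trajectories involved stay in a compact set. *)
Lemma envelope_lip (r eps : R) : 0 < eps -> exists2 L, 0 < L & forall a b,
  `|a| <= r -> `|b| <= r -> envelope a <= Num.max eps (envelope b + L * `|a - b|).
Proof.
move=> eps0.
pose r' := n.+1%:R * `|r|.
have r'0 : 0 <= r' by rewrite mulr_ge0.
(* An excess above [eps] at time [t] forces [beta r' t > eps], hence [t < T]. *)
have [T T0 HT] := classKL_small betaKL r'0 eps0.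
(* A positive excess forces [gam M < beta r' 0], and [M <= gam M] by [gam_ge]. *)
pose M0 := beta r' 0.
have [C HC] := bounded_reach f_lip f00 f_complete M0 r T.
have [A A0 HA] := gronwall f_lip (Num.max C M0) T0.
have [Lh [Lh0 hL]] := loclip_norm h_lip C.
exists (Lh * A); first by rewrite mulr_gt0.
move=> a b ar br; apply: envelope_le => _ [M [u [x [t [uM tx t0 ->]]]]].
have [le_eps|gt_eps] := leP (`|h (x t)| - 2 * gam M) eps.
  by rewrite le_max le_eps.
rewrite le_max; apply/orP; right.
have ar' : eucl a <= r'.
  apply: le_trans (eucl_le_norm a) _; rewrite ler_wpM2l//.
  by apply: le_trans ar _; exact: ler_norm.
have Mg := gam_ge (adm_ge0 uM); have M_ge0 := adm_ge0 uM.
have b1 := ios uM tx t0.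
have b2 := classK_le (proj1 betaKL t t0) (eucl_ge0 a) ar'.
have b3 := proj1 (proj2 betaKL _ r'0) 0 t (lexx 0) t0.
have tT : t <= T.
  by rewrite leNgt; apply/negP => Tt; have := HT t (ltW Tt); simpl in b2; lra.
have uM0 : adm M0 u by apply: adm_le uM; rewrite /M0; simpl in b2; lra.
have [y ty] := f_complete b uM.
have tT' : 0 <= t <= T by rewrite t0.
have xC s : 0 <= s <= T -> `|x s| <= C by move=> sT; exact: HC ar uM0 tx sT.
have yC s : 0 <= s <= T -> `|y s| <= C by move=> sT; exact: HC br uM0 ty sT.
have xy : `|x t - y t| <= A * `|a - b|.
  apply: (HA a b u x y tx ty) => // s sT.
  - by rewrite le_max (adm_norm _ uM0) orbT.
  - by rewrite le_max xC.
  - by rewrite le_max yC.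
have hxy : `|h (x t) - h (y t)| <= Lh * A * `|a - b|.
  apply: le_trans (hL _ _ (xC t tT') (yC t tT')) _.
  by rewrite -mulrA ler_wpM2l// ltW.
have : excess b (`|h (y t)| - 2 * gam M) by exists M, u, y, t.
move=> /excess_le_envelope; have := ler_normD (h (x t) - h (y t)) (h (y t)).
by rewrite subrK; lra.
Qed.

(* On the ball of radius [r], the weight [c k] cancels the Lipschitz constant [L k]
   at all levels [k >= r]; the finitely many other levels are summed in [B]. *)
Lemma flat_envelope_loclip : exists c : nat -> R, (forall k, 0 < c k <= 1) /\
  loclip (scal1 (fun xi => flatten_at c (envelope xi))).
Proof.
have eps0 k : 0 < k.+1%:R^-1 :> R by rewrite invr_gt0 ltr0n.
have Lex (r : R) : exists L : nat -> R, forall k, 0 < L k /\ forall a b,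
    `|a| <= r -> `|b| <= r -> envelope a <= Num.max k.+1%:R^-1 (envelope b + L k * `|a - b|).
  have H k : exists L, 0 < L /\ forall a b, `|a| <= r -> `|b| <= r ->
      envelope a <= Num.max k.+1%:R^-1 (envelope b + L * `|a - b|).
    by have [L L0 HL] := envelope_lip r (eps0 k); exists L.
  by have /choice[L HL] := H; exists L.
have /choice[L HL] : forall k : nat, exists L, 0 < L /\ forall a b,
    `|a| <= k%:R -> `|b| <= k%:R ->
    envelope a <= Num.max k.+1%:R^-1 (envelope b + L * `|a - b|).
  by move=> k; have [L L0 HL] := envelope_lip k%:R (eps0 k); exists L.
(* This weight is at most 1 and satisfies [c k * L k <= 1]. *)
pose c k := (1 + L k)^-1.
have c01 k : 0 < c k <= 1.
  have Lk := proj1 (HL k); have L1 : 0 < 1 + L k by rewrite addr_gt0.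
  by rewrite invr_gt0 L1 invf_le1// lerDl ltW.
exists c; split=> // r.
have [L' HL'] := Lex r.
pose N := (Num.trunc r).+1.
have rN : r <= N%:R by rewrite ltW// truncnS_gt.
pose B := 1 + \sum_(k < N) L' k.
have B0 : 0 <= B.
  by rewrite addr_ge0// sumr_ge0// => k _; exact: ltW (proj1 (HL' k)).
(* If [envelope a] is at most the level [1 / (k + 1)], its hinge vanishes; otherwise the Lipschitz
   estimate passes through the hinge. *)
have hin (a b : 'rV[R]_n) k (K : R) : 0 < K ->
    envelope a <= Num.max k.+1%:R^-1 (envelope b + K * `|a - b|) ->
    hinge k (envelope a) - hinge k (envelope b) <= K * `|a - b|.
  move=> K0; have Kd : 0 <= K * `|a - b| by rewrite mulr_ge0// ltW.
  have hb := hinge_ge0 k (envelope b).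
  have hb2 : envelope b - k.+1%:R^-1 <= hinge k (envelope b) by rewrite le_max lexx.
  rewrite lerBlDr {1}/hinge le_max ge_max => /orP[ae|ae]; apply/andP; split.
  - by apply: (@le_trans _ _ 0); [rewrite subr_le0|rewrite addr_ge0].
  - by rewrite addr_ge0.
  - by move: hb2 ae; move: (k.+1%:R^-1) => ? ? ?; lra.
  - by rewrite addr_ge0.
have half a b : `|a| <= r -> `|b| <= r ->
    flatten_at c (envelope a) <= flatten_at c (envelope b) + B * `|a - b|.
  move=> ar br; apply: flatten_lip => //; rewrite ?envelope_ge0// ?mulr_ge0//.
  move=> k; have /andP[ck0 ck1] := c01 k.
  have [kN|Nk] := ltnP k N.
    have H := hin a b k _ (proj1 (HL' k)) (proj2 (HL' k) a b ar br).
    apply: (@le_trans _ _ (c k * (L' k * `|a - b|))); first by rewrite ler_pM2l.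
    apply: (@le_trans _ _ (L' k * `|a - b|)).
      by rewrite ler_piMl// mulr_ge0// ltW// (proj1 (HL' k)).
    rewrite ler_wpM2r// /B (bigD1 (Ordinal kN))//= addrCA lerDl addr_ge0//.
    by apply: sumr_ge0 => j _; exact: ltW (proj1 (HL' j)).
  have rk : r <= k%:R by apply: le_trans rN _; rewrite ler_nat.
  have H := hin a b k _ (proj1 (HL k)) (proj2 (HL k) a b (le_trans ar rk) (le_trans br rk)).
  apply: (@le_trans _ _ (c k * (L k * `|a - b|))); first by rewrite ler_pM2l.
  rewrite mulrA ler_wpM2r//; apply: (@le_trans _ _ 1).
    by rewrite /c mulrC ler_pdivrMr ?mul1r ?lerDr// addr_gt0//; exact: (proj1 (HL k)).
  by rewrite /B lerDl sumr_ge0// => j _; exact: ltW (proj1 (HL' j)).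
exists B => a b ar br.
have ar' := le_trans (norm_le_eucl a) ar; have br' := le_trans (norm_le_eucl b) br.
rewrite /eucl big_ord1 !mxE sqrtr_sqr.
apply: (@le_trans _ _ (B * `|a - b|)); last by rewrite ler_wpM2l// norm_le_eucl.
have := half a b ar' br'; have := half b a br' ar'; rewrite [`|b - a|]distrC.
by rewrite ler_norml; lra.
Qed.

End OutputEnvelope.

(** * The equivalence *)

Lemma eucl_scal1 (R : realType) n (g : 'rV[R]_n -> R) xi :
  0 <= g xi -> eucl (scal1 g xi) = g xi.
Proof. by move=> g0; rewrite /eucl big_ord1 !mxE sqrtr_sqr ger0_norm. Qed.

(** A substitute for subadditivity, as a sum is at most twice its larger term; it separates the
    contributions of state and input. *)
Lemma classK_addl (R : realType) (g : R -> R) (x y : R) : classK g ->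
  0 <= x -> 0 <= y -> g (x + y) <= Num.max (g (2 * x)) (g (2 * y)).
Proof.
move=> gK x0 y0; rewrite le_max; have [xy|yx] := leP x y; apply/orP.
  by right; apply: classK_le => //; [rewrite addr_ge0|lra].
by left; apply: classK_le => //; [rewrite addr_ge0|lra].
Qed.

Theorem theorem2p1 (R : realType) (n m p : nat)
  (f : 'rV[R]_n -> 'rV[R]_m -> 'rV[R]_n) (h : 'rV[R]_n -> 'rV[R]_p) :
  loclip2 f -> loclip h -> f 0 0 = 0 -> h 0 = 0 ->
  (IOS f h <->
   exists h0 : 'rV[R]_n -> R,
     loclip (scal1 h0) /\ (forall xi, 0 <= h0 xi) /\ h0 0 = 0 /\
     exists chi : R -> R, classKinf chi /\
       (forall xi, chi (eucl (h xi)) <= h0 xi) /\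
       OLIOS f (scal1 h0)).
Proof.
move=> fL hL f00 h00; have f_lip := loclip2_norm fL; split; last first.
  (* From (2) to (1): the inverse [k] of [chi] turns the bound on [h0] into one on [h], and
     [classK_addl] splits its argument. *)
  move=> [h0 [_ [h0_ge0 [_ [chi [chiK [chih [[fc [b [g [bKL [gK ios]]]]] _]]]]]]]].
  have [k [kK kchi _]] := classKinf_inv chiK.
  have lt02 : 0 < 2 :> R by [].
  split=> //; exists (fun s t => k (2 * b s t)), (fun s => k (2 * g s)).
  split; first exact: classKL_comp_scale.
  split; first exact: classK_comp_scale.
  move=> xi u x M iu sx uM t t0.
  have b0 := classKL_ge0 bKL (eucl_ge0 xi) t0.
  have g0 := classK_ge0 gK (ess_bounded_ge0 uM).
  have k1 : 0 <= k (2 * b (eucl xi) t) by apply: classK_ge0 => //; rewrite mulr_ge0.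
  have k2 : 0 <= k (2 * g M) by apply: classK_ge0 => //; rewrite mulr_ge0.
  rewrite -(kchi _ (eucl_ge0 (h (x t)))).
  apply: (@le_trans _ _ (k (b (eucl xi) t + g M))).
    apply: classK_le => //; first by apply: classK_ge0; [exact: (proj1 chiK)|exact: eucl_ge0].
    apply: le_trans (chih _) _; rewrite -(eucl_scal1 (h0_ge0 (x t))).
    exact: ios iu sx uM t t0.
  by apply: le_trans (classK_addl kK b0 g0) _; rewrite ge_max lerDl lerDr k1 k2.
move=> [fc [b [g [bKL [gK ios]]]]].
have f_complete (M : R) u xi : adm M u -> exists x, traj f xi u x.
  by move=> uM; have [x /solutionP tx] := fc xi u (adm_input uM); exists x.
pose gam s := g s + s.
have gamK : classK gam by exact: classK_add_id.
have gam_ge s : 0 <= s -> s <= gam s.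
  by move=> s0; rewrite lerDr; exact: classK_ge0.
have ios' (M : R) xi u x t : adm M u -> traj f xi u x -> 0 <= t ->
    `|h (x t)| <= b (eucl xi) t + gam M.
  move=> uM tx t0; apply: le_trans (norm_le_eucl _) _.
  have /solutionP sx := tx.
  have := ios xi u x M (adm_input uM) sx (adm_ess uM) t t0.
  by rewrite /gam; have := adm_ge0 uM; lra.
pose V := envelope f h gam.
have V_ge0 xi : 0 <= V xi := envelope_ge0 f_complete bKL gamK ios' xi.
have [c [c01 lipV]] := flat_envelope_loclip f_lip f00 f_complete hL bKL gamK gam_ge ios'.
have rhoK := classKinf_flatten c01; set rho := flatten_at c in lipV rhoK.
have rho_ge0 xi : 0 <= rho (V xi) by apply: classK_ge0 => //; exact: (proj1 rhoK).
have [k [kK krho _]] := classKinf_inv rhoK.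
have Vtraj xi u x (M t : R) : input u -> solution f xi u x -> ess_bounded u M -> 0 <= t ->
    V (x t) <= V xi + 2 * gam M /\ V (x t) <= b (eucl xi) t + gam M.
  move=> iu /solutionP tx uM t0.
  have [v vM tv] := traj_clip f_lip iu tx uM.
  exact: (envelope_traj f_complete bKL gamK ios' vM tv t0).
exists (fun xi => rho (V xi)); split; first exact: lipV.
split=> //; split.
  by rewrite /V (envelope0 f_complete bKL gamK ios') (proj1 (proj1 rhoK)).
(* The envelope dominates the maximum norm of the output; the factor [1 / (p + 1)] passes to it from
   the Euclidean norm. *)
have q0 : 0 < p.+1%:R^-1 :> R by rewrite invr_gt0 ltr0n.
exists (fun s => rho (p.+1%:R^-1 * s)); split.
  split; first exact: (classK_comp_scale q0 (proj1 rhoK) (@classK_id R)).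
  move=> M; have [s [s0 Ms]] := (proj2 rhoK) M.
  exists (p.+1%:R * s); split; first by rewrite mulr_ge0.
  by rewrite mulrA mulVf ?mul1r// pnatr_eq0.
split.
  move=> xi; apply: classK_le; first exact: (proj1 rhoK).
    by rewrite mulr_ge0 ?eucl_ge0// ltW.
  rewrite mulrC ler_pdivrMr ?ltr0n// mulrC.
  apply: le_trans (eucl_le_norm _) _; rewrite ler_wpM2l//.
  exact: (norm_output_le_envelope f_complete bKL gamK ios' xi).
split.
  split=> //; exists (fun s t => rho (2 * b s t)), (fun s => rho (2 * gam s)).
  split; first by apply: classKL_comp_scale => //; exact: (proj1 rhoK).
  split; first by apply: classK_comp_scale => //; exact: (proj1 rhoK).
  move=> xi u x M iu sx uM t t0; rewrite eucl_scal1//.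
  have b0 := classKL_ge0 bKL (eucl_ge0 xi) t0.
  have g0 := classK_ge0 gamK (ess_bounded_ge0 uM).
  have k1 : 0 <= rho (2 * b (eucl xi) t).
    by apply: classK_ge0; [exact: (proj1 rhoK)|rewrite mulr_ge0].
  have k2 : 0 <= rho (2 * gam M) by apply: classK_ge0; [exact: (proj1 rhoK)|rewrite mulr_ge0].
  apply: (@le_trans _ _ (rho (b (eucl xi) t + gam M))).
    apply: classK_le => //; first exact: (proj1 rhoK).
    exact: (proj2 (Vtraj _ _ _ _ _ iu sx uM t0)).
  apply: le_trans (classK_addl (proj1 rhoK) b0 g0) _.
  by rewrite ge_max lerDl lerDr k1 k2.
(* [k] recovers [V xi] from the output [rho (V xi)]; the factors 2 and 4 arise when [classK_addl]
   splits [V xi + 2 * gam M]. *)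
exists (fun s => rho (2 * k s)), (fun s => rho (4 * gam s)).
split; first by apply: classK_comp_scale => //; exact: (proj1 rhoK).
split; first by apply: classK_comp_scale => //; exact: (proj1 rhoK).
move=> xi u x M iu sx uM t t0; rewrite !eucl_scal1// krho//.
have g0 := classK_ge0 gamK (ess_bounded_ge0 uM).
have g20 : 0 <= 2 * gam M by rewrite mulr_ge0.
have -> : 4 * gam M = 2 * (2 * gam M) by ring.
apply: le_trans (classK_addl (proj1 rhoK) (V_ge0 xi) g20).
apply: classK_le => //; first exact: (proj1 rhoK).
exact: (proj1 (Vtraj _ _ _ _ _ iu sx uM t0)).
Qed.
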